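(* Let $G$ be a block graph with diameter $3$, and let $B$ be the central block of $G$. Then $G$ is $\chi_\rho$-critical if and only if one of the following three possibilities holds for the vertices of $B$. (a) Every vertex of $B$ has degree $|V(B)|$ in $G$. (b) Every vertex of $B$ has degree $|V(B)|+1$ in $G$, and exactly $|V(B)|-1$ vertices of $B$ have two neighbors that are leaves. (c) For each vertex $x \in V(B)$ at least one of the following holds: (c1) $x$ belongs to at least one side block of order at least $4$, and $x$ has no leaf neighbor; (c2) $x$ belongs to at least two side blocks of order $3$, and $x$ has no leaf neighbor; (c3) $x$ has degree $|V(B)|+1$ in $G$ and has two neighbors that are both leaves; and in addition, at least one vertex of $B$ satisfies (c1) or (c2).
   Context: Graphs are finite and simple. A block of $G$ is a maximal connected subgraph without cut vertices; a block graph is a connected graph in which every block is a complete graph. The order of a block is its number of vertices; a leaf is a vertex of degree 1, and a leaf neighbor of $x$ is a leaf adjacent to $x$. For a block graph $G$ of diameter $3$, the radius is $2$ and the center (the set of vertices of minimum eccentricity) is exactly the vertex set of one block, called the central block $B$; all other blocks are called side blocks. A $k$-packing coloring of $G$ is a map $c:V(G)\to\{1,\ldots,k\}$ such that two distinct vertices $u,v$ with $c(u)=c(v)=i$ satisfy $d_G(u,v)>i$ (distance between vertices in different components is infinite); $\chi_\rho(G)$ is the smallest $k$ for which such a coloring exists. $G$ is $\chi_\rho$-critical if $\chi_\rho(H)<\chi_\rho(G)$ for every proper subgraph $H$ of $G$. *)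

(* Defs.v *)
(* Simple graphs: vertex type T : finType, adjacency e : rel T
   (assumed symmetric and irreflexive in the theorem). *)
From mathcomp Require Import all_boot.
Set Implicit Arguments. Unset Strict Implicit. Unset Printing Implicit Defensive.

Section Graphs.
Variable T : finType.

Fixpoint ball (E : rel T) (n : nat) (x : T) : {set T} :=
  match n with
  | 0 => [set x]
  | n'.+1 => ball E n' x :|: [set y | [exists z in ball E n' x, E z y]]
  end.

Definition induced (e : rel T) (S : {set T}) : rel T :=
  [rel x y | [&& e x y, x \in S & y \in S]].

(* the induced subgraph G[S] is connected (vacuous for S empty) *)
Definition conn_set (e : rel T) (S : {set T}) : Prop :=
  forall x y, x \in S -> y \in S -> connect (induced e S) x y.

(* G[S] (assumed connected) has no cut vertex *)
Definition no_cut_vertex (e : rel T) (S : {set T}) : Prop :=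
  forall v, v \in S -> conn_set e (S :\ v).

(* S is the vertex set of a block: a maximal connected subgraph without
   cut vertices (such maximal subgraphs are induced). *)
Definition is_block (e : rel T) (S : {set T}) : Prop :=
  [/\ conn_set e S, no_cut_vertex e S &
      forall S' : {set T}, S \subset S' -> conn_set e S' -> no_cut_vertex e S' -> S' = S].

Definition block_graph (e : rel T) : Prop :=
  conn_set e setT /\
  forall S, is_block e S -> forall x y, x \in S -> y \in S -> x != y -> e x y.

Definition diameter3 (e : rel T) : Prop :=
  (forall x y, y \in ball e 3 x) /\ exists x y, y \notin ball e 2 x.

(* x has minimum eccentricity: whenever some vertex reaches all vertices
   within k steps, so does x. *)
Definition in_center (e : rel T) (x : T) : Prop :=
  forall y k, ball e k y = setT -> ball e k x = setT.

Definition deg (e : rel T) (x : T) : nat := #|[set y | e x y]|.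
Definition leaf (e : rel T) (y : T) : bool := deg e y == 1.
Definition leaf_nbrs (e : rel T) (x : T) : {set T} :=
  [set y | e x y & leaf e y].

(* k-packing coloring of the graph (V, E), colors 1..k (0 unused on V);
   d(u,v) > i  <->  v \notin ball E i u *)
Definition packing_colorable (E : rel T) (V : {set T}) (k : nat) : bool :=
  [exists c : {ffun T -> 'I_k.+1},
    [forall u in V, c u != ord0] &&
    [forall u in V, forall v in V,
       ((u != v) && (c u == c v)) ==> (v \notin ball E (c u) u)]].

(* packing chromatic number: least k such that (V,E) is k-packing colorable
   (a coloring with #|T| colors always exists) *)
Definition chi_rho (E : rel T) (V : {set T}) : nat :=
  find (packing_colorable E V) (iota 0 #|T|.+2).

Definition is_subgraph (e : rel T) (V' : {set T}) (E' : rel T) : Prop :=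
  symmetric E' /\ forall x y, E' x y -> [&& e x y, x \in V' & y \in V'].

Definition proper_subgraph (e : rel T) (V' : {set T}) (E' : rel T) : Prop :=
  V' != setT \/ exists x y, e x y && ~~ E' x y.

Definition chi_rho_critical (e : rel T) : Prop :=
  forall V' E', is_subgraph e V' E' -> proper_subgraph e V' E' ->
    chi_rho E' V' < chi_rho e setT.

Definition side_block (e : rel T) (B S : {set T}) : Prop :=
  is_block e S /\ S != B.

Definition condA (e : rel T) (B : {set T}) : Prop :=
  forall x, x \in B -> deg e x = #|B|.

Definition condB (e : rel T) (B : {set T}) : Prop :=
  (forall x, x \in B -> deg e x = #|B|.+1) /\
  #|[set x in B | #|leaf_nbrs e x| == 2]| = #|B| - 1.

Definition c1 (e : rel T) (B : {set T}) (x : T) : Prop :=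
  (exists S, [/\ side_block e B S, x \in S & 4 <= #|S|]) /\ leaf_nbrs e x = set0.

Definition c2 (e : rel T) (B : {set T}) (x : T) : Prop :=
  (exists S1 S2, [/\ side_block e B S1, side_block e B S2, S1 != S2,
      (x \in S1) && (x \in S2) & (#|S1| == 3) && (#|S2| == 3)]) /\
  leaf_nbrs e x = set0.

Definition c3 (e : rel T) (B : {set T}) (x : T) : Prop :=
  deg e x = #|B|.+1 /\ #|leaf_nbrs e x| = 2.

Definition condC (e : rel T) (B : {set T}) : Prop :=
  (forall x, x \in B -> [\/ c1 e B x, c2 e B x | c3 e B x]) /\
  exists x, x \in B /\ (c1 e B x \/ c2 e B x).

End Graphs.

(* Main.v *)
Require Import Defs.
From mathcomp Require Import all_boot zify.
Set Implicit Arguments. Unset Strict Implicit. Unset Printing Implicit Defensive.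

(** Every vertex outside the central block [B] has a unique neighbour in [B], its
    home, and adjacent outside vertices share their home and lie in a common
    clique. Hence a packing colouring is a partition into an independent set
    (colour 1), a set of outside vertices with distinct homes or a singleton
    (colour 2), and singletons. It suffices to delete single edges.

    Necessity: when none of the three conditions holds, some edge can be deleted
    so that every colouring of the remaining graph can be turned into one of the
    whole graph without new colours, mostly by exchanging the colours of two
    vertices.

    Sufficiency: in case (a), a colouring with [#|B|] colours would use all of
    them on [B], leaving none for the leaf attached to the vertex coloured 1. In
    cases (b) and (c), the colours 1 and 2 cover at most [#|R| + g] vertices,
    where [R] is a maximal independent set outside [B] and [g] is the number of
    vertices of [B] without leaf neighbours; after the deletion of any edge, the
    colours 1, 2 and 3 cover two vertices more than that. *)

(** In the whole graph every colour above 2 occurs at most once, because no distance exceeds 3. So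
    [|R| + g] vertices in the first two colours force at least [#|T| + 2 - |R| - g] colours, while
    three colours on [|R| + g + 2] vertices lead to [#|T| + 1 - |R| - g]. Of the two further
    vertices one merely pays for the use of colour 3; the other is the colour saved. The deletions
    either enlarge one of the first two classes, or move private vertices of different homes so far
    apart that colour 3 can be used twice. A core vertex coloured 1 would spoil the count. It can be
    swapped away when each cluster has at least two private vertices, since one of them then has a
    colour above 2. In case (a) clusters are too small for this, whence the separate argument. *)

Section General.
Variable T : finType.
Implicit Types (E : rel T) (V : {set T}).

(** * Balls, packing colourings and the reduction to single edges *)

Lemma ballSP E n x y :
  reflect (y \in ball E n x \/ exists2 z, z \in ball E n x & E z y)
          (y \in ball E n.+1 x).
Proof.
rewrite /= !inE; apply: (iffP orP) => [[->|/existsP[z /andP[zb Ezy]]]|[->|[z zb Ezy]]].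
- by left.
- by right; exists z.
- by left.
- by right; apply/existsP; exists z; rewrite zb.
Qed.

Lemma ball_refl E n x : x \in ball E n x.
Proof. by elim: n => [|n IHn]; [rewrite inE | apply/ballSP; left]. Qed.

Lemma ball_le E m n x y : m <= n -> y \in ball E m x -> y \in ball E n x.
Proof.
by elim: n => [|n IHn]; [rewrite leqn0 => /eqP->|
  rewrite leq_eqVlt => /orP[/eqP->//|/IHn{}IHn /IHn ?]; apply/ballSP; left].
Qed.

Lemma ball_mono E E' n x : subrel E E' -> {subset ball E n x <= ball E' n x}.
Proof.
move=> sub; elim: n => [//|n IHn] y /ballSP[/IHn yb|[z /IHn zb /sub Ezy]].
  by apply/ballSP; left.
by apply/ballSP; right; exists z.
Qed.

Lemma ball_step E n x y z : y \in ball E n x -> (y == z) || E y z ->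
  z \in ball E n.+1 x.
Proof.
move=> yb /orP[/eqP<-|Eyz]; first by apply/ballSP; left.
by apply/ballSP; right; exists y.
Qed.

Lemma ball1P E x y : reflect (y = x \/ E x y) (y \in ball E 1 x).
Proof.
apply: (iffP (ballSP _ _ _ _)) => [[|[z]]|[->|Exy]]; rewrite /= ?inE.
- by move/eqP; left.
- by move/eqP->; right.
- by left.
- by right; exists x; rewrite ?inE.
Qed.

(* Colourings as plain functions: [c u] is the colour of [u], and [0] is not a
   colour. *)
Definition packing E V k (c : T -> nat) : Prop :=
  (forall u, u \in V -> 0 < c u <= k) /\
  forall u v, u \in V -> v \in V -> u != v -> c u = c v -> v \notin ball E (c u) u.

Lemma packing_colorableP E V k :
  reflect (exists c, packing E V k c) (packing_colorable E V k).
Proof.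
apply: (iffP existsP) => [[c /andP[/forall_inP c0 /forall_inP cP]]|[c [c0 cP]]].
  exists (fun u => nat_of_ord (c u)); split=> [u uV|u v uV vV nuv cuv].
    by rewrite lt0n -ltnS ltn_ord andbT; apply: c0.
  have /forall_inP/(_ v vV)/implyP := cP u uV; apply.
  by rewrite nuv /=; apply/eqP/val_inj.
exists [ffun u => inord (c u)].
have cE u : u \in V -> (inord (c u) : 'I_k.+1) = c u :> nat.
  by move=> /c0/andP[_ ?]; rewrite inordK.
apply/andP; split; first apply/forall_inP=> u uV.
  by rewrite ffunE -val_eqE /= cE // -lt0n; case/andP: (c0 u uV).
apply/forall_inP=> u uV; apply/forall_inP=> v vV; rewrite !ffunE.
apply/implyP=> /andP[nuv /eqP/(congr1 val)/=]; rewrite !cE // => cuv.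
exact: cP.
Qed.

Lemma packing_sub E E' V V' k c : subrel E' E -> V' \subset V ->
  packing E V k c -> packing E' V' k c.
Proof.
move=> sE /subsetP sV [c0 cP]; split=> [u /sV|u v /sV uV /sV vV nuv cuv].
  exact: c0.
by apply: contra (cP _ _ uV vV nuv cuv); apply: ball_mono.
Qed.

Lemma packing_colorable_le E V k k' : k <= k' ->
  packing_colorable E V k -> packing_colorable E V k'.
Proof.
move=> lekk' /packing_colorableP[c [c0 cP]]; apply/packing_colorableP; exists c.
by split=> // u /c0 /andP[-> /leq_trans->].
Qed.

Lemma packing_colorable_card E V : packing_colorable E V #|T|.
Proof.
apply/packing_colorableP; exists (fun u => (enum_rank u).+1); split=> [u _|u v _ _].
  by rewrite /= ltn_ord.
by move=> /eqP nuv [/val_inj/enum_rank_inj].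
Qed.

(** The list searched by [chi_rho] starts at 0, so position and value agree; the search succeeds
    because an injective colouring exists, and colourability is monotone in [k]. *)
Lemma chi_rho_leP E V k : (chi_rho E V <= k) = packing_colorable E V k.
Proof.
have some : has (packing_colorable E V) (iota 0 #|T|.+2).
  apply/hasP; exists #|T|; last exact: packing_colorable_card.
  by rewrite mem_iota; lia.
have chiP : packing_colorable E V (chi_rho E V).
  have := nth_find 0 some; rewrite nth_iota ?add0n //.
  by rewrite -[X in _ < X](size_iota 0) -has_find.
have min j : packing_colorable E V j -> j < #|T|.+2 -> chi_rho E V <= j.
  move=> cj jlt; rewrite leqNgt; apply/negP => /(before_find 0).
  by rewrite nth_iota // add0n cj.
apply/idP/idP => [le_k|ck]; first exact: packing_colorable_le le_k chiP.
case: (ltnP k #|T|.+2) => [|lek]; first exact: min.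
by apply: leq_trans (min _ (packing_colorable_card E V) _) _; lia.
Qed.

Definition del_edge E a b : rel T :=
  [rel u v | E u v && ((u, v) != (a, b)) && ((u, v) != (b, a))].

Lemma del_edge_sub E a b : subrel (del_edge E a b) E.
Proof. by move=> u v /andP[/andP[]]. Qed.

Lemma del_edge_sym E a b : symmetric E -> symmetric (del_edge E a b).
Proof.
move=> symE u v; rewrite /del_edge /= symE -!andbA !xpair_eqE.
by case: (u == a); case: (u == b); case: (v == a); case: (v == b).
Qed.

Lemma del_edge_neq E a b u v :
  E u v -> (u != a) && (v != a) || (u != b) && (v != b) -> del_edge E a b u v.
Proof. by rewrite /del_edge /= !xpair_eqE => ->; do 4!case: eqP. Qed.

Lemma del_edgeN E a b u v : E u v -> ~~ del_edge E a b u v ->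
  (u = a /\ v = b) \/ (u = b /\ v = a).
Proof.
by rewrite /del_edge /= !xpair_eqE => -> /=; case: eqP; case: eqP; case: eqP; case: eqP; auto.
Qed.

(** A proper subgraph misses some edge: a missing vertex takes an edge with it, as no vertex is
    isolated. A colouring of the graph without that edge restricts to the subgraph. The number [k]
    separates the two chromatic numbers. *)
Lemma critical_iff (e : rel T) : symmetric e -> (forall x, exists y, e x y) ->
  chi_rho_critical e <->
  forall a b, e a b ->
    exists2 k, packing_colorable (del_edge e a b) setT k
             & ~~ packing_colorable e setT k.
Proof.
move=> esym nbr; split=> [crit a b eab|edge V' E' [E'sym E'e] prop].
  exists (chi_rho (del_edge e a b) setT); first by rewrite -chi_rho_leP.
  rewrite -chi_rho_leP -ltnNge; apply: crit.
    split=> [|u v /del_edge_sub euv]; last by rewrite euv !inE.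
    exact: del_edge_sym.
  by right; exists a, b; rewrite /del_edge /= eab eqxx andbF.
have [a [b [eab nE'ab]]] : exists a b, e a b /\ ~~ E' a b.
  case: prop => [VT|[a [b /andP[]]]]; last by exists a, b.
  have /subsetPn[a _ aV'] : ~~ (setT \subset V') by rewrite subTset.
  have [b eab] := nbr a; exists a, b; split=> //.
  by apply/negP => /E'e; rewrite (negPf aV') andbF.
have [k kdel kG] := edge a b eab.
rewrite -chi_rho_leP -ltnNge in kG; apply: leq_ltn_trans kG.
rewrite chi_rho_leP; have /packing_colorableP[c cP] := kdel.
apply/packing_colorableP; exists c; apply: packing_sub cP; last exact: subsetT.
move=> u v E'uv; have /and3P[euv _ _] := E'e u v E'uv.
rewrite /del_edge /= euv !xpair_eqE /=; apply/andP; split; apply: contra nE'ab.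
  by case/andP=> /eqP<- /eqP<-.
by case/andP=> /eqP<- /eqP<-; rewrite E'sym.
Qed.

End General.

(* [h] sends every vertex outside the core [B] to its unique neighbour in [B],
   and fixes [B] pointwise. *)
Record clustered (T : finType) (e : rel T) (B : {set T}) (h : T -> T) : Prop :=
  Clustered {
    cl_sym : symmetric e;
    cl_irr : irreflexive e;
    home_in : forall v, h v \in B;
    home_id : forall x, x \in B -> h x = x;
    core_clique : forall x y, x \in B -> y \in B -> x != y -> e x y;
    home_adj : forall v, v \notin B -> e (h v) v;
    adj_home : forall u v, e u v -> h u = h v \/ (u \in B /\ v \in B);
    side_trans : forall u v w, u \notin B -> v \notin B -> w \notin B ->
      e u v -> e v w -> u != w -> e u w;
    two_homes : exists u v, [/\ u \notin B, v \notin B & h u != h v]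
  }.

(** * Block graphs of diameter 3 are clustered around the central block *)

Section Blocks.
Variables (T : finType) (e : rel T).
Hypotheses (esym : symmetric e) (eirr : irreflexive e).
Implicit Types S W : {set T}.

Lemma induced_sym S : symmetric (induced e S).
Proof. by move=> x y; rewrite /induced /= esym [_ && (y \in S)]andbC. Qed.

Lemma conn_root S r :
  (forall y, y \in S -> connect (induced e S) y r) -> conn_set e S.
Proof.
move=> toR x y xS yS; apply: connect_trans (toR x xS) _.
by rewrite (sym_connect_sym (induced_sym S)); apply: toR.
Qed.

Lemma clique_conn S : (forall x y, x \in S -> y \in S -> x != y -> e x y) ->
  conn_set e S.
Proof.
move=> cl x y xS yS; have [->|nxy] := eqVneq x y; first exact: connect0.
by apply: connect1; rewrite /induced /= cl // xS.
Qed.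

Lemma clique_no_cut S : (forall x y, x \in S -> y \in S -> x != y -> e x y) ->
  no_cut_vertex e S.
Proof.
move=> cl v _; apply: clique_conn => x y /setD1P[_ xS] /setD1P[_ yS].
exact: cl.
Qed.

Lemma sub_block S : conn_set e S -> no_cut_vertex e S ->
  exists2 S', is_block e S' & S \subset S'.
Proof.
pose conn (A : {set T}) :=
  [forall x in A, forall y in A, connect (induced e A) x y].
have connP A : reflect (conn_set e A) (conn A).
  apply: (iffP forall_inP) => [c x y xA yA|c x xA].
    by have /forall_inP/(_ y yA) := c x xA.
  by apply/forall_inP => y; apply: c.
pose biconn (A : {set T}) := conn A && [forall v in A, conn (A :\ v)].
have biconnP A : reflect (conn_set e A /\ no_cut_vertex e A) (biconn A).
  apply: (iffP andP) => -[/connP c n]; split=> //.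
    by move=> v vA; apply/connP; apply: (forall_inP n).
  by apply/forall_inP => v vA; apply/connP; apply: n.
move=> cS nS; have /maxset_exists[S' /maxsetP[/biconnP[cS' nS'] max] SS'] :
  biconn S by apply/biconnP.
exists S' => //; split=> // A SA cA nA; apply: max => //.
by apply/biconnP.
Qed.

Section Absorption.
Variable B : {set T}.
Hypotheses (Bblock : is_block e B)
  (Bclique : forall x y, x \in B -> y \in B -> x != y -> e x y).
Variables x x' : T.
Hypotheses (xB : x \in B) (x'B : x' \in B) (nxx' : x != x').

(** If every vertex of [W] keeps a way into the clique [B] after the loss of any vertex [u], then
    the union of [B] and [W] is connected without cut vertex, and maximality of the block applies.
    The two distinct vertices [x] and [x'] ensure that [B :\ u] is never empty. *)
Lemma block_absorbs W :
  (forall u y, y \in W -> y != u -> exists2 z, z \in B :\ u &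
     connect (induced e ((B :|: W) :\ u)) y z) ->
  W \subset B.
Proof.
move=> link; have [_ _ Bmax] := Bblock.
have other u : exists2 r, r \in B & r != u.
  by have [xu|nxu] := eqVneq x u; [exists x'; rewrite // eq_sym -xu | exists x].
suff <- : B :|: W = B by apply: subsetUr.
have cut u : conn_set e ((B :|: W) :\ u).
  have [r rB nru] := other u; apply: (conn_root (r := r)) => y.
  have inB z : z \in B -> z != u -> connect (induced e ((B :|: W) :\ u)) z r.
    move=> zB nzu; have [->|nzr] := eqVneq z r; first exact: connect0.
    by apply: connect1; rewrite /induced /= Bclique // !inE nzu nru zB rB.
  rewrite !inE => /andP[nyu /orP[yB|yW]]; first exact: inB.
  have [z /setD1P[nzu zB] yz] := link u y yW nyu.
  by apply: connect_trans yz (inB _ zB nzu).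
apply: Bmax; [exact: subsetUl | | by move=> u _; apply: cut].
apply: (conn_root (r := x)) => y yBW.
have [->|nyx] := eqVneq y x; first exact: connect0.
case/setUP: (yBW) => [yB|yW].
  by apply: connect1; rewrite /induced /= Bclique // !inE yB xB.
have [z /setD1P[nzx zB] yz] := link x y yW nyx.
apply: (@connect_trans _ _ z).
  apply: connect_sub yz => a b /and3P[eab /setD1P[_ aS] /setD1P[_ bS]].
  by apply: connect1; apply/and3P.
by apply: connect1; rewrite /induced /= Bclique // !inE zB xB.
Qed.

Lemma connect_step S u a b : e a b -> a \in S -> b \in S -> a != u -> b != u ->
  connect (induced e (S :\ u)) a b.
Proof.
move=> eab aS bS nau nbu; apply: connect1.
by rewrite /induced /= eab !in_setD1 nau nbu aS.
Qed.

(** This lemma and the next two exclude ears, that is, paths of length 2, 3 or 4 between distinct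
    vertices of the block through outside vertices. Deleting one vertex of such a path leaves every
    other inner vertex joined to one of the two ends. *)
Lemma no_ear1 v : e x v -> e v x' -> v \in B.
Proof.
move=> exv evx'; suff /subsetP/(_ v) : [set v] \subset B by apply; rewrite inE.
apply: block_absorbs => u y /set1P-> nvu.
have [xu|nxu] := eqVneq x u.
  have nx'u : x' != u by rewrite -xu eq_sym.
  by exists x'; rewrite ?in_setD1 ?nx'u // connect_step // !inE ?eqxx ?x'B ?orbT.
exists x; rewrite ?in_setD1 ?nxu // connect_step // 1?esym //;
  by rewrite !inE ?eqxx ?xB ?orbT.
Qed.

Lemma notin_neq a b : a \in B -> b \notin B -> (b != a) * (a != b).
Proof. by move=> aB bB; split; [apply: contraNneq bB => -> | apply: contraNneq bB => <-]. Qed.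

Lemma no_ear2 w w' : w \notin B -> w' \notin B ->
  e x w -> e w w' -> e w' x' -> False.
Proof.
move=> wB w'B exw eww' ew'x'; pose W := [set w; w'].
have nx'x : x' != x by rewrite eq_sym.
suff /subsetP/(_ w) : W \subset B by rewrite !inE eqxx (negPf wB) => /(_ isT).
have S1 := subsetP (subsetUl B W).
have wS : w \in B :|: W by rewrite !inE eqxx orbT.
have w'S : w' \in B :|: W by rewrite !inE eqxx !orbT.
apply: block_absorbs => u y /set2P[]-> nu.
- have [<-|nxu] := eqVneq x u.
    exists x'; first by rewrite in_setD1 eq_sym nxx'.
    apply: (@connect_trans _ _ w'); apply: connect_step;
      by rewrite // ?S1 ?notin_neq.
  by exists x; [rewrite in_setD1 nxu | apply: connect_step; rewrite // 1?esym // ?S1].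
- have [<-|nx'u] := eqVneq x' u.
    exists x; first by rewrite in_setD1 nxx'.
    apply: (@connect_trans _ _ w); apply: connect_step;
      by rewrite // 1?esym // ?S1 ?notin_neq.
  by exists x'; [rewrite in_setD1 nx'u | apply: connect_step; rewrite // ?S1].
Qed.

Lemma no_ear3 w v w' : w \notin B -> v \notin B -> w' \notin B -> w != w' ->
  e x w -> e w v -> e v w' -> e w' x' -> False.
Proof.
move=> wB vB w'B nww' exw ewv evw' ew'x'; pose W := [set w; v; w'].
have nx'x : x' != x by rewrite eq_sym.
have nw'w : w' != w by rewrite eq_sym.
suff /subsetP/(_ w) : W \subset B by rewrite !inE eqxx (negPf wB) => /(_ isT).
have S1 := subsetP (subsetUl B W).
have wS : w \in B :|: W by rewrite !inE eqxx orbT.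
have vS : v \in B :|: W by rewrite !inE eqxx !orbT.
have w'S : w' \in B :|: W by rewrite !inE eqxx !orbT.
apply: block_absorbs => u y yW nu.
have [yw|yw'|yv] : [\/ y = w, y = w' | y = v].
- by move: yW; rewrite !inE -orbA => /or3P[]/eqP ?;
    [constructor 1 | constructor 3 | constructor 2].
- rewrite {}yw in nu *; have [<-|nxu] := eqVneq x u.
    exists x'; first by rewrite in_setD1 nx'x.
    apply: (@connect_trans _ _ v); first by apply: connect_step; rewrite // ?notin_neq.
    apply: (@connect_trans _ _ w'); apply: connect_step;
      by rewrite // ?S1 ?notin_neq.
  by exists x; [rewrite in_setD1 nxu | apply: connect_step; rewrite // 1?esym // ?S1].
- rewrite {}yw' in nu *; have [<-|nx'u] := eqVneq x' u.
    exists x; first by rewrite in_setD1 nxx'.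
    apply: (@connect_trans _ _ v).
      by apply: connect_step; rewrite // 1?esym // ?notin_neq.
    apply: (@connect_trans _ _ w); apply: connect_step;
      by rewrite // 1?esym // ?S1 ?notin_neq.
  by exists x'; [rewrite in_setD1 nx'u | apply: connect_step; rewrite // ?S1].
- rewrite {}yv in nu *.
  have [/andP[nxu nwu]|] := boolP ((x != u) && (w != u)).
    exists x; first by rewrite in_setD1 nxu.
    by apply: (@connect_trans _ _ w); apply: connect_step; rewrite // 1?esym // ?S1.
  rewrite negb_and !negbK => uE.
  have [nx'u nw'u] : x' != u /\ w' != u.
    by case/orP: uE => /eqP<-; rewrite ?(notin_neq xB w'B) ?(notin_neq x'B wB).
  exists x'; first by rewrite in_setD1 nx'u.
  by apply: (@connect_trans _ _ w'); apply: connect_step; rewrite // ?S1.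
Qed.
End Absorption.

Lemma block_graph_clustered B : block_graph e -> diameter3 e ->
  is_block e B -> (forall x, x \in B <-> in_center e x) ->
  exists h, clustered e B h.
Proof.
move=> [_ blockC] [diam3 [a [b nab]]] Bblock cenP.
have Bclique := blockC B Bblock.
have biclique S : conn_set e S -> no_cut_vertex e S ->
    forall x y, x \in S -> y \in S -> x != y -> e x y.
  move=> cS nS x y xS yS; have [S' bS' /subsetP sub] := sub_block cS nS.
  by apply: (blockC S' bS'); apply: sub.
(* If no vertex had eccentricity at most 2, all vertices would be central, so [B] would be the whole
   vertex set; but [B] is a clique. *)
have [y ecy] : exists y, ball e 2 y = setT.
  apply/exists_eqP; apply: contraNT nab => /existsPn nec.
  have BT z : z \in B.
    apply/cenP => y k; have [k3 _|k2 kT] := leqP 3 k.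
      apply/eqP; rewrite eqEsubset subsetT; apply/subsetP => u _.
      exact: ball_le k3 (diam3 z u).
    case/negP: (nec y); rewrite eqEsubset subsetT -kT; apply/subsetP => u.
    by apply: ball_le; rewrite -ltnS.
  have [->|nab] := eqVneq a b; first exact: ball_refl.
  by apply: (@ball_le _ _ 1) => //; apply/ball1P; right; apply: Bclique.
have no_ecc1 z k : k <= 1 -> ball e k z != setT.
  move=> k1; apply: contraNneq nab => kT.
  have z1 w : w = z \/ e z w.
    by apply/ball1P; apply: ball_le k1 _; rewrite kT inE.
  apply: (@ball_step _ _ _ _ z); last by case: (z1 b) => ->; rewrite ?eqxx ?orbT.
  by apply/ball1P; case: (z1 a) => [->|]; [left | rewrite esym; right].
have ecB x : x \in B -> ball e 2 x = setT by move/cenP/(_ _ _ ecy).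
have yB : y \in B.
  apply/cenP => z k kT; have [k2|k1] := leqP 2 k.
    apply/eqP; rewrite eqEsubset subsetT -ecy; apply/subsetP => u.
    exact: ball_le.
  by have := no_ecc1 z k k1; rewrite kT eqxx.
(* Were [y] the only vertex of [B], an edge at [y] would be a larger connected set without cut
   vertex. *)
have [y' y'B nyy'] : exists2 y', y' \in B & y != y'.
  have [z eyz] : exists z, e y z.
    have /subsetPn[w _] : ~~ (setT \subset ball e 1 y).
      by rewrite subTset; apply: no_ecc1.
    have : w \in ball e 2 y by rewrite ecy inE.
    case/ballSP=> [->//|[z /ball1P[->|eyz] ezw] _]; first by exists w.
    by exists z.
  have nyz : y != z by apply: contraTneq eyz => ->; rewrite eirr.
  have [zB|zB] := boolP (z \in B); first by exists z.
  apply/exists_inP; apply: contraNT zB => /exists_inPn only.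
  have BE w : w \in B -> w = y by move/only; rewrite negbK => /eqP.
  have [_ _ Bmax] := Bblock.
  have cl : forall u v, u \in [set y; z] -> v \in [set y; z] -> u != v -> e u v.
    move=> u v /set2P[]-> /set2P[]->; rewrite ?eqxx // 1?esym //.
  rewrite -(Bmax [set y; z]) ?inE ?eqxx ?orbT //.
  - by apply/subsetP => w /BE->; rewrite !inE eqxx.
  - exact: clique_conn.
  - exact: clique_no_cut.
(* Both [y] and [y'] reach [v] within two steps. If [v] had no neighbour in [B], the middle
   vertices, together with [v] when they differ, would form an ear between [y] and [y']. *)
have nbrB v : v \notin B -> exists2 x, x \in B & e x v.
  move=> vB; have via x : x \in B -> (exists2 x, x \in B & e x v) \/
      exists w, [/\ w \notin B, e x w & e w v].
    move=> xB; have : v \in ball e 2 x by rewrite ecB.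
    case/ballSP=> [/ball1P[vx|exv]|[w /ball1P[->|exw] ewv]].
    - by rewrite vx xB in vB.
    - by left; exists x.
    - by left; exists x.
    - by have [wB|wB] := boolP (w \in B); [left; exists w | right; exists w].
  have [//|[w [wB eyw ewv]]] := via y yB.
  have [//|[w' [w'B ey'w' ew'v]]] := via y' y'B.
  rewrite esym in ey'w'; have [ww'|nww'] := eqVneq w w'.
    by case/negP: wB; apply: (no_ear1 Bblock Bclique yB y'B nyy') => //; rewrite ww'.
  rewrite esym in ew'v.
  by case: (no_ear3 Bblock Bclique yB y'B nyy' wB vB w'B nww' eyw ewv ew'v ey'w').
pose h v := if v \in B then v else odflt v [pick x in B | e x v].
have hP v : v \notin B -> h v \in B /\ e (h v) v.
  move=> vB; rewrite /h (negPf vB); case: pickP => [x /andP[]//|none].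
  by have [x xB exv] := nbrB v vB; have := none x; rewrite xB exv.
have hid x : x \in B -> h x = x by rewrite /h => ->.
have huniq x v : x \in B -> v \notin B -> e x v -> x = h v.
  move=> xB vB exv; have [hB hv] := hP v vB; rewrite esym in hv.
  apply/eqP; apply: contraNT vB => nx.
  exact: (no_ear1 Bblock Bclique xB hB nx).
have adj u v : e u v -> h u = h v \/ (u \in B /\ v \in B).
  move=> euv; have [uB|uB] := boolP (u \in B); have [vB|vB] := boolP (v \in B).
  - by right.
  - by left; rewrite hid // -(huniq u v).
  - by left; rewrite (hid v) // -(huniq v u) // esym.
  left; have [huB hu] := hP u uB; have [hvB hv] := hP v vB; rewrite esym in hv.
  apply/eqP/negPn/negP => nh.
  exact: (no_ear2 Bblock Bclique huB hvB nh uB vB).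
exists h; split=> //.
- by move=> v; have [vB|/hP[]//] := boolP (v \in B); rewrite hid.
- by move=> v /hP[].
- move=> u v w uB vB wB euv evw nuw.
  have hE p q : p \notin B -> q \notin B -> e p q -> h p = h q.
    by move=> pB qB /adj[//|[]]; rewrite (negPf pB).
  have [xB exu] := hP u uB; have [_ exv] := hP v vB; have [_ exw] := hP w wB.
  rewrite -(hE _ _ vB wB evw) -(hE _ _ uB vB euv) in exv exw.
  set x := h u in xB exu exv exw.
  (* The home [x] is adjacent to all three others and [u], [v], [w] is a path, so [S] stays
     connected after the loss of any vertex; it therefore lies in a block, which is a clique. *)
  pose S := [set x; u; v; w].
  have inS t : t \in S -> [\/ t = x, t = u, t = v | t = w].
    by rewrite !inE -!orbA => /or4P[]/eqP->; constructor.
  have [xS uS vS wS] : [/\ x \in S, u \in S, v \in S & w \in S].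
    by rewrite !inE !eqxx !orbT.
  have link p q r : p \in S -> q \in S -> r \in S -> (p == q) || e p q -> p != r -> q != r ->
      connect (induced e (S :\ r)) p q.
    move=> pS qS _ /orP[/eqP-> _ _|epq pr qr]; first exact: connect0.
    exact: connect_step.
  have nx t : t \notin B -> t != x by move=> tB; apply: contraNneq tB => ->.
  have cut : no_cut_vertex e S.
    move=> r rS; have [rx|nrx] := eqVneq r x.
      apply: (conn_root (r := v)) => t /setD1P[tr tS]; apply: link => //.
        case: (inS t tS) => E; rewrite E ?euv ?eqxx ?orbT //.
          by rewrite E rx eqxx in tr.
        by rewrite esym evw orbT.
      by rewrite rx nx.
    apply: (conn_root (r := x)) => t /setD1P[tr tS]; apply: link => //; last by rewrite eq_sym.
    by case: (inS t tS) => ->; rewrite ?eqxx //= esym ?exu ?exv ?exw orbT.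
  apply: (biclique S) => //; apply: (conn_root (r := x)) => t tS.
  have [->|ntx] := eqVneq t x; first exact: connect0.
  apply: connect1; rewrite /induced /= tS xS.
  by case: (inS t tS) ntx => ->; rewrite ?eqxx //= esym ?exu ?exv ?exw.
(* Two vertices at distance above 2 are not central, and a common home would put them at distance
   2. *)
- have aB : a \notin B by apply: contraNN nab => /ecB->; rewrite inE.
  have bB : b \notin B.
    apply: contraNN nab => bB; have : a \in ball e 2 b by rewrite ecB // inE.
    case/ballSP=> [/ball1P[->|eba]|[z /ball1P[->|ebz] eza]].
    - exact: ball_refl.
    - by apply: (@ball_le _ _ 1) => //; apply/ball1P; right; rewrite esym.
    - by apply: (@ball_le _ _ 1) => //; apply/ball1P; right; rewrite esym.
    - apply: (@ball_step _ _ _ _ z); last by rewrite esym ebz orbT.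
      by apply/ball1P; right; rewrite esym.
  exists a, b; split=> //; apply: contraNneq nab => hab.
  apply: (@ball_step _ _ _ _ (h a)); last by rewrite hab; have [_ ->] := hP b bB; rewrite orbT.
  by apply/ball1P; right; rewrite esym; have [_ ->] := hP a aB.
Qed.
End Blocks.

(** * Private neighbours of core vertices, and the three conditions in their terms *)

Section Clusters.
Variables (T : finType) (e : rel T) (B : {set T}) (h : T -> T).
Hypothesis cl : clustered e B h.

Let esym : symmetric e := cl_sym cl.

Definition priv (x : T) : {set T} := [set v | (v \notin B) && (h v == x)].
(** For a vertex outside [B] this means being a leaf, since its home is its only neighbour in
    [B]. *)
Definition lone (v : T) : bool := [forall w, (w \notin B) ==> ~~ e v w].

Lemma adj_neq u v : e u v -> u != v.
Proof. by apply: contraTneq => ->; rewrite (cl_irr cl). Qed.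

Lemma in_priv x v : (v \in priv x) = (v \notin B) && (h v == x).
Proof. by rewrite inE. Qed.

Lemma privP x v : v \in priv x -> v \notin B /\ h v = x.
Proof. by rewrite inE => /andP[? /eqP]. Qed.

Lemma priv_adj x v : v \in priv x -> e x v.
Proof. by case/privP=> vB <-; apply: home_adj cl _ vB. Qed.

Lemma core_notin x v : x \in B -> v \notin B -> x != v.
Proof. by move=> xB; apply: contraNneq => <-. Qed.

Lemma core_adj x v : x \in B -> v \notin B -> e x v -> h v = x.
Proof.
by move=> xB vB /(adj_home cl)[<-|[_]]; [rewrite (home_id cl) | rewrite (negPf vB)].
Qed.

Lemma side_adj u v : u \notin B -> e u v -> h u = h v.
Proof. by move=> uB /(adj_home cl)[//|[]]; rewrite (negPf uB). Qed.

Lemma core_other x : exists2 y, y \in B & y != x.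
Proof.
have [u [v [_ _ nuv]]] := two_homes cl.
have [hux|] := eqVneq (h u) x; last by exists (h u); first exact: home_in cl _.
by exists (h v); [exact: home_in cl _ | rewrite -hux eq_sym].
Qed.

Lemma priv_other x : exists2 v, v \notin B & h v != x.
Proof.
have [u [v [uB vB nuv]]] := two_homes cl.
have [hux|] := eqVneq (h u) x; last by exists u.
by exists v; rewrite // -hux eq_sym.
Qed.

Lemma nbr_exists x : exists y, e x y.
Proof.
have [xB|xB] := boolP (x \in B); last by exists (h x); rewrite esym (home_adj cl).
by have [y yB nyx] := core_other x; exists y; apply: (core_clique cl); rewrite // eq_sym.
Qed.

Lemma deg_core x : x \in B -> deg e x = #|B|.-1 + #|priv x|.
Proof.
move=> xB; rewrite /deg.
have -> : [set y | e x y] = (B :\ x) :|: priv x.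
  apply/setP => y; rewrite !inE; have [yB|yB] /= := boolP (y \in B).
    rewrite orbF andbT; have [->|nyx] := eqVneq y x; first exact: cl_irr cl x.
    by apply: (core_clique cl); rewrite // eq_sym.
  rewrite andbF /=; apply/idP/eqP => [|<-]; first exact: core_adj.
  exact: home_adj cl _ yB.
rewrite cardsU disjoint_setI0 ?cards0 ?subn0 ?(cardsD1 x B) ?xB //.
by rewrite disjoint_subset; apply/subsetP => y; rewrite !inE => /andP[_ ->].
Qed.

Lemma card_core : 1 < #|B|.
Proof.
have [u [v [_ _ nuv]]] := two_homes cl.
by apply/card_gt1P; exists (h u), (h v); rewrite !(home_in cl).
Qed.

(** The shift by one comes from the core, where [x] has [#|B| - 1] neighbours. *)
Lemma deg_core_eq x k : x \in B -> (deg e x = #|B| + k) <-> #|priv x| = k.+1.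
Proof. by move=> xB; rewrite deg_core //; have := card_core; lia. Qed.

Lemma side_leaf v : v \notin B -> leaf e v = lone v.
Proof.
move=> vB; rewrite /leaf /deg.
have hv : h v \in [set y | e v y] by rewrite inE esym (home_adj cl).
apply/cards1P/forallP => [[y Ey] w|lonev].
  apply/implyP => wB; apply/negP => evw.
  have wv : w \in [set y | e v y] by rewrite inE.
  have := core_notin (home_in cl v) wB; rewrite Ey in hv wv.
  by move/set1P: hv => ->; move/set1P: wv => ->; rewrite eqxx.
exists (h v); apply/setP => y; rewrite in_set1; apply/idP/eqP => [|->//].
rewrite inE => evy; have /implyP := lonev y.
have [yB _|_ /(_ isT)] := boolP (y \in B); last by rewrite evy.
by rewrite (side_adj vB evy) (home_id cl).
Qed.

Lemma core_nleaf x : x \in B -> ~~ leaf e x.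
Proof.
move=> xB; suff : 1 < deg e x by rewrite /leaf; lia.
rewrite /deg; apply/card_gt1P; have [y yB nyx] := core_other x.
have exB z : z \in B -> z != x -> e x z.
  by move=> zB nzx; apply: (core_clique cl); rewrite // eq_sym.
have [/eqP P0|/set0Pn[p pP]] := boolP (priv x == set0).
  have [u [v [uB vB nuv]]] := two_homes cl.
  have nh w : w \notin B -> h w != x.
    move=> wB; apply: contraTneq isT => hw.
    by have := in_set0 w; rewrite -P0 !inE wB hw eqxx.
  by exists (h u), (h v); rewrite !inE !exB ?(home_in cl) ?nh.
exists y, p; rewrite !inE exB // priv_adj // core_notin //.
by case/privP: pP.
Qed.

Lemma leaf_nbrs_core x : x \in B -> leaf_nbrs e x = [set v in priv x | lone v].
Proof.
move=> xB; apply/setP => v; rewrite !inE.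
have [vB|vB] /= := boolP (v \in B); first by rewrite (negPf (core_nleaf vB)) andbF.
rewrite side_leaf //; congr andb; apply/idP/eqP => [|<-]; first exact: core_adj.
exact: home_adj cl _ vB.
Qed.

Lemma nloneP v : reflect (exists2 w, w \notin B & e v w) (~~ lone v).
Proof.
rewrite negb_forall; apply: (iffP existsP) => -[w].
  by rewrite negb_imply negbK => /andP[]; exists w.
by exists w; rewrite negb_imply negbK; apply/andP.
Qed.

Lemma loneP v w : lone v -> w \notin B -> e v w = false.
Proof. by move=> /forallP/(_ w)/implyP lv /lv/negPf. Qed.

Lemma no_leaf_nbrP x : x \in B ->
  reflect (forall v, v \in priv x -> ~~ lone v) (leaf_nbrs e x == set0).
Proof.
move=> xB; rewrite leaf_nbrs_core //.
apply: (iffP eqP) => [E v vP|nl].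
  by apply/negP => lv; have := in_set0 v; rewrite -E inE vP lv.
by apply/setP => v; rewrite in_set in_set0; apply/negP => /andP[/nl/negP].
Qed.

(** If the clique [S] met [B] in a second vertex, each vertex of [S] outside [B] would have two
    homes; so [S] would lie inside [B] and equal it by maximality. *)
Lemma side_block_priv S x : block_graph e -> is_block e B -> side_block e B S ->
  x \in B -> x \in S -> S :\ x \subset priv x.
Proof.
move=> [_ blockC] [cB nB _] [Sb SB] xB xS; have Scl := blockC S Sb.
have [_ _ Smax] := Sb.
apply/subsetP => v /setD1P[nvx vS].
have vB : v \notin B.
  apply: contra SB => vB; rewrite eq_sym; apply/eqP/Smax => //; apply/subsetP => w wS.
  apply/negPn/negP => wB; case/eqP: nvx.
  rewrite -(core_adj vB wB) ?Scl ?(core_notin vB) //.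
  by rewrite (core_adj xB wB) ?Scl ?(core_notin xB).
by rewrite in_priv vB (core_adj xB vB) ?eqxx ?Scl // eq_sym.
Qed.

Definition side_class v : {set T} := [set w | (w \notin B) && ((w == v) || e v w)].

(** By transitivity of side adjacency this set is a clique. A larger block would be a clique through
    [v], all of whose neighbours are already present. *)
Lemma side_class_block v : block_graph e -> v \notin B ->
  side_block e B (h v |: side_class v).
Proof.
move=> [_ blockC] vB.
have hvB := home_in cl v.
have hw w : w \in side_class v -> w \notin B /\ h w = h v.
  by rewrite inE => /andP[wB /orP[/eqP->|/(side_adj vB)->]].
have cls : forall x y, x \in h v |: side_class v -> y \in h v |: side_class v ->
    x != y -> e x y.
  have homeE w : w \in side_class v -> e (h v) w.
    by case/hw => wB <-; apply: home_adj cl _ wB.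
  move=> x y /setU1P[->|xS] /setU1P[->|yS]; rewrite ?eqxx //.
  - by move=> _; apply: homeE.
  - by move=> _; rewrite esym; apply: homeE.
  - move: xS yS; rewrite !inE => /andP[xB /orP[/eqP->|evx]] /andP[yB /orP[/eqP->|evy]] //.
    + by rewrite eqxx.
    + by rewrite esym.
    + by apply: (side_trans cl) evy => //; rewrite esym.
have vS : v \in h v |: side_class v by rewrite !inE vB eqxx orbT.
split; last by apply: contraNneq vB => <-.
split; [exact: clique_conn | exact: clique_no_cut |].
move=> S' sub cS' nS'; apply/eqP; rewrite eqEsubset sub andbT.
have [S'' bS'' /subsetP sub'] := sub_block cS' nS'.
apply/subsetP => w /sub' wS''; have evw : v != w -> e v w.
  by apply: (blockC S'') => //; apply: sub'; apply: (subsetP sub).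
rewrite !inE; have [wB|wB] /= := boolP (w \in B).
  rewrite orbF -(home_id cl wB) -(side_adj vB) ?evw //.
  by rewrite eq_sym core_notin.
by apply/orP; right; have [->|nwv] //= := eqVneq w v; rewrite evw // eq_sym.
Qed.

(** In a cluster without leaves each side class has at least two vertices. If none has three, a
    cluster of three or more vertices contains two classes of size two, which is (c2). Conversely,
    two distinct side blocks of order 3 at [x] cannot fit into a cluster of two vertices. *)
Lemma c12P x : block_graph e -> is_block e B -> x \in B ->
  (c1 e B x \/ c2 e B x) <-> (leaf_nbrs e x = set0 /\ 2 < #|priv x|).
Proof.
move=> bg bB xB; split.
  case=> [[[S [Sb xS S4]] ->]|[[S1 [S2 [S1b S2b nS /andP[xS1 xS2] /andP[S13 S23]]]] ->]];
    split=> //.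
    have := subset_leq_card (side_block_priv bg bB Sb xB xS).
    by move: S4; rewrite (cardsD1 x S) xS; lia.
  have sub1 := side_block_priv bg bB S1b xB xS1.
  have sub2 := side_block_priv bg bB S2b xB xS2.
  have [c1 c2] : #|S1 :\ x| = 2 /\ #|S2 :\ x| = 2.
    by move: S13 S23; rewrite (cardsD1 x S1) (cardsD1 x S2) xS1 xS2; lia.
  rewrite ltnNge; apply: contra nS => P2.
  have E1 : S1 :\ x = priv x by apply/eqP; rewrite eqEcard sub1 c1.
  have E2 : S2 :\ x = priv x by apply/eqP; rewrite eqEcard sub2 c2.
  by rewrite -(setD1K xS1) -(setD1K xS2) E1 E2.
move=> [nl P3]; have /eqP/(no_leaf_nbrP xB) nlone := nl.
have cls v : v \in priv x -> [/\ side_block e B (x |: side_class v),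
    x \in x |: side_class v, v \in side_class v &
    #|x |: side_class v| = #|side_class v|.+1 /\ 2 <= #|side_class v|].
  move=> vP; have [vB hv] := privP vP; rewrite -[in x |: _]hv.
  have vv : v \in side_class v by rewrite inE vB eqxx.
  split=> //; rewrite ?inE ?hv ?eqxx //; first by rewrite -hv; apply: side_class_block.
  rewrite cardsU1 inE xB; split=> //.
  have /nloneP[w wB evw] := nlone v vP.
  by apply/card_gt1P; exists v, w; rewrite !inE vB wB evw eqxx orbT adj_neq.
have [v vP] : exists v, v \in priv x by apply/card_gt0P; apply: leq_trans P3.
have [vb xv vv [cv2 cv]] := cls v vP.
have [big|small] := ltnP 2 #|side_class v|.
  by left; split=> //; exists (x |: side_class v); rewrite cv2.
have /subsetPn[w wP wv] : ~~ (priv x \subset side_class v).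
  by apply: contraL P3 => /subset_leq_card; lia.
have [wb xw ww [cw2 cw]] := cls w wP.
have [big|small'] := ltnP 2 #|side_class w|.
  by left; split=> //; exists (x |: side_class w); rewrite cw2.
right; split=> //; exists (x |: side_class v), (x |: side_class w).
split=> //; last by rewrite cv2 cw2; lia.
  apply: contraNneq wv => E; have : w \in x |: side_class v by rewrite E setU1r.
  by case/setU1P=> // wx; case/privP: wP; rewrite wx xB.
by rewrite xv xw.
Qed.

Lemma c3P x : x \in B ->
  c3 e B x <-> (#|priv x| = 2 /\ forall v, v \in priv x -> lone v).
Proof.
move=> xB; rewrite /c3 -addn1 deg_core_eq // leaf_nbrs_core //.
have sub : [set v in priv x | lone v] \subset priv x.
  by apply/subsetP => v; rewrite inE => /andP[].
split=> -[P2]; rewrite P2; [move=> L2 | move=> all]; split=> //.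
  move=> v vP; have : v \in [set v in priv x | lone v]; last by rewrite inE => /andP[].
  suff -> : [set v in priv x | lone v] = priv x by [].
  by apply/eqP; rewrite eqEcard sub P2 L2.
rewrite -P2; apply: eq_card => v; rewrite inE.
by case: (boolP (v \in priv x)) => // /all->.
Qed.

Lemma condAP : condA e B <-> forall x, x \in B -> #|priv x| = 1.
Proof.
split=> H x xB; have := H x xB; have := deg_core_eq 0 xB; rewrite addn0; tauto.
Qed.

(** In a cluster of two vertices both are leaves or neither is, because each is the only possible
    side neighbour of the other. So the one core vertex without two leaf neighbours has none. *)
Lemma condBP : condB e B <-> exists y, [/\ y \in B, #|priv y| = 2,
    forall v, v \in priv y -> ~~ lone v
  & forall x, x \in B -> x != y ->
      #|priv x| = 2 /\ forall v, v \in priv x -> lone v].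
Proof.
pose L := [set x in B | #|leaf_nbrs e x| == 2].
have LB : L \subset B by apply/subsetP => x; rewrite inE => /andP[].
have m1 := card_core.
split=> [[degB cL]|[y [yB y2 yN oth]]].
  have P2 x : x \in B -> #|priv x| = 2.
    by move=> xB; apply/deg_core_eq; rewrite // addn1 degB.
  have : #|B :\: L| == 1 by rewrite cardsD (setIidPr LB) cL; lia.
  case/cards1P=> y yE; have /setDP[yB yL] : y \in B :\: L by rewrite yE inE.
  have LP x : x \in B -> x != y -> x \in L.
    move=> xB; apply: contraNT => xL.
    by rewrite -in_set1 -yE inE xL.
  exists y; split=> //; first exact: P2.
    move=> v vP; apply: contra yL => lv; rewrite inE yB /= leaf_nbrs_core //.
    rewrite -(P2 y yB); apply/eqP; apply: eq_card => w; rewrite inE.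
    have [wP|//] := boolP (w \in priv y); rewrite /=.
    have [->//|nwv] := eqVneq w v.
    apply/forallP => u; apply/implyP => uB; apply/negP => ewu.
    have [wB hw] := privP wP; have [vB hv] := privP vP.
    have uP : u \in priv y by rewrite in_priv uB -(side_adj wB ewu) hw eqxx.
    have nvu : v != u by apply: contraTneq ewu => <-; rewrite esym loneP.
    have : [set w; v; u] \subset priv y.
      by apply/subsetP => z; rewrite !inE -orbA => /or3P[]/eqP->; rewrite -in_priv.
    move/subset_leq_card; rewrite (P2 y yB) setUC cardsU1 cards2 !inE nwv.
    by rewrite negb_or ![u == _]eq_sym nvu (adj_neq ewu).
  move=> x xB nxy; have := LP x xB nxy; rewrite inE => /andP[_ /eqP l2].
  by apply/c3P => //; split=> //; rewrite degB.
split=> [x xB|].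
  rewrite -addn1; apply/deg_core_eq => //.
  by have [->//|nxy] := eqVneq x y; case: (oth x xB nxy).
suff -> : [set x in B | #|leaf_nbrs e x| == 2] = B :\ y.
  by rewrite (cardsD1 y B) yB; lia.
apply/setP => x; rewrite !inE andbC.
have [xB|_] := boolP (x \in B); last by rewrite !andbF.
rewrite !andbT.
have [->|nxy] := eqVneq x y.
  by have /(no_leaf_nbrP yB)/eqP-> := yN; rewrite cards0.
by have /(c3P xB)[_ ->] := oth x xB nxy.
Qed.

End Clusters.

(** * Necessity: recolourings that undo the deletion of an edge *)

Section Recolouring.
Variables (T : finType) (e : rel T) (B : {set T}) (h : T -> T).
Hypothesis cl : clustered e B h.

Let sym_e : symmetric e := cl_sym cl.

Notation priv := (priv B h).
Notation lone := (lone e B).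
Notation core_notin := (@core_notin T B).
Notation loneP := (@loneP T e B).

Definition sep u v := [&& u \notin B, v \notin B & h u != h v].

(** There is no clause for [i] above 2, because no distance exceeds 3. *)
Definition compat i u v := (i = 1 /\ ~~ e u v) \/ (i = 2 /\ sep u v).

(* The packing colourings of a clustered graph: distances are at most 3, and
   two vertices are at distance 3 exactly when they are separated. *)
Definition good (A : {set T}) k (c : T -> nat) : Prop :=
  (forall v, v \in A -> 0 < c v <= k) /\
  forall u v, u \in A -> v \in A -> u != v -> c u = c v -> compat (c u) u v.

Lemma sep_sym u v : sep u v = sep v u.
Proof. by rewrite /sep eq_sym; case: (u \in B); case: (v \in B). Qed.

Lemma compat_sym i u v : compat i u v -> compat i v u.
Proof. by rewrite /compat sep_sym sym_e. Qed.

Lemma sep_far u v : sep u v -> v \notin ball e 2 u.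
Proof.
move=> /and3P[uB vB nh]; apply/ballSP=> -[/ball1P[vu|euv]|[z /ball1P[->|euz] ezv]].
- by rewrite vu eqxx in nh.
- by rewrite (side_adj cl uB euv) eqxx in nh.
- by rewrite (side_adj cl uB ezv) eqxx in nh.
- by rewrite (side_adj cl uB euz) (side_adj cl vB (v := z)) ?eqxx // sym_e in nh.
Qed.

Lemma good_packing k c : good setT k c -> packing e setT k c.
Proof.
move=> [c0 cP]; split=> // u v uA vA nuv cuv.
have [[-> neuv]|[-> /and3P[uB vB nh]]] := cP u v uA vA nuv cuv.
  by apply/ball1P => -[vu|]; [rewrite vu eqxx in nuv | apply/negP].
by apply: sep_far; rewrite /sep uB vB.
Qed.

(** Serves to transfer colourings from a graph [E] with missing edges to [e]. Vertices of equal
    colour are too close because of an edge between them, for colour 1, or because of the route [u],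
    [h u], [h v], [v]; the three edge hypotheses keep these in [E]. *)
Lemma packing_good E A k c : packing E A k c ->
  (forall u v, u \in A -> v \in A -> c u = 1 -> c v = 1 -> e u v -> E u v) ->
  (forall v, v \in A -> v \notin B -> E v (h v) /\ E (h v) v) ->
  (forall u v, u \in A -> v \in A -> h u != h v -> E (h u) (h v)) ->
  good A k c.
Proof.
move=> [c0 cP] E1 Eh EB; split=> // u v uA vA nuv cuv.
have far := cP u v uA vA nuv cuv.
have up w : w \in A -> (w == h w) || E w (h w).
  move=> wA; have [wB|wB] := boolP (w \in B); first by rewrite (home_id cl wB) eqxx.
  by case: (Eh w wA wB) => -> _; rewrite orbT.
have down w : w \in A -> (h w == w) || E (h w) w.
  move=> wA; have [wB|wB] := boolP (w \in B); first by rewrite (home_id cl wB) eqxx.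
  by case: (Eh w wA wB) => _ ->; rewrite orbT.
have across : (h u == h v) || E (h u) (h v).
  by have [//|nh] := eqVneq (h u) (h v); rewrite EB.
have hu : h u \in ball E 1 u by apply: ball_step (up u uA); rewrite inE.
case ci : (c u) => [|[|[|i]]].
- by have := c0 u uA; rewrite ci.
- left; split=> //; apply: contraNN far => euv; rewrite ci.
  by apply/ball1P; right; apply: E1; rewrite -?cuv.
- right; split=> //; rewrite ci in far.
  apply/and3P; split; apply: contraNN far => H.
  + apply: ball_step (down v vA); apply: ball_step across.
    by rewrite (home_id cl H) inE.
  + by rewrite -(home_id cl H); apply: ball_step across.
  + by apply: ball_step hu _; rewrite (eqP H) down.
- case/negP: far; rewrite ci; apply: (@ball_le _ _ 3) => //.
  exact: ball_step (ball_step hu across) (down v vA).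
Qed.

Lemma good_colorableP k :
  (exists c, good setT k c) <-> packing_colorable e setT k.
Proof.
split=> [[c /good_packing cP]|/packing_colorableP[c cP]].
  by apply/packing_colorableP; exists c.
exists c; apply: packing_good cP _ _ _ => [//|v _ vB|u v _ _ nh].
  by rewrite sym_e (home_adj cl).
by rewrite (core_clique cl) ?(home_in cl).
Qed.

Lemma good_neq A k c u v : good A k c -> u \in A -> v \in A -> u \in B -> e u v ->
  c u != c v.
Proof.
move=> [_ cP] uA vA uB euv; apply/eqP => cuv.
have [[_]|[_]] := cP u v uA vA (adj_neq cl euv) cuv; first by rewrite euv.
by rewrite /sep uB.
Qed.

Lemma good_set (A : {set T}) k c q i : good (A :\ q) k c -> 0 < i <= k ->
  (forall v, v \in A :\ q -> c v = i -> compat i q v) ->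
  good A k (fun v => if v == q then i else c v).
Proof.
move=> [c0 cP] ik iP; split=> [v vA|u v uA vA].
  by have [//|nvq] := eqVneq v q; apply: c0; rewrite !inE nvq.
have [->|nuq] := eqVneq u q; have [->|nvq] := eqVneq v q; rewrite ?eqxx //.
- by move=> _ /esym cv; apply: iP; rewrite // !inE nvq.
- by move=> _ cu; rewrite cu; apply/compat_sym/iP; rewrite // !inE nuq.
- by move=> nuv cuv; apply: cP; rewrite // !inE ?nuq ?nvq.
Qed.

Lemma good_sub (A A' : {set T}) k c : A' \subset A -> good A k c -> good A' k c.
Proof. by move=> /subsetP s [c0 cP]; split=> [v /s/c0|u v /s uA /s]; last exact: cP. Qed.

Lemma good_swap A k c a b : good A k c -> a \in A -> b \in A -> c a != c b ->
  (forall v, v \in A -> v != a -> v != b -> c v = c a -> compat (c a) b v) ->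
  (forall v, v \in A -> v != a -> v != b -> c v = c b -> compat (c b) a v) ->
  good A k (fun v => if v == a then c b else if v == b then c a else c v).
Proof.
move=> [c0 cP] aA bA /eqP nab Pa Pb; split=> [v vA|u v uA vA].
  by case: eqP => _; [apply: c0 | case: eqP => _; apply: c0].
have [->|nua] := eqVneq u a; have [->|nva] := eqVneq v a; rewrite ?eqxx //.
- by have [_ _ /esym//|nvb _ cv] := eqVneq v b; apply: Pb.
- have [_ _//|nub _ cu] := eqVneq u b.
  by rewrite cu; apply/compat_sym/Pb.
- have [->|nub] := eqVneq u b; have [->|nvb] := eqVneq v b; rewrite ?eqxx //.
  + by move=> _ cv; apply: Pa.
  + by move=> _ cu; rewrite cu; apply/compat_sym/Pa.
  + exact: cP.
Qed.

Lemma good_big A k c a v : good A k c -> a \in A -> v \in A -> v != a ->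
  2 < c a -> c v = c a -> False.
Proof.
move=> [_ cP] aA vA nva a2 cva.
by have [[]|[]] := cP v a vA aA nva cva; rewrite cva => E; rewrite E in a2.
Qed.

(* Both private vertices miss colour 1 and share a home, so they cannot both be
   coloured 2. *)
Lemma priv_colour3 A k c y p q : good A k c -> y \in A -> p \in A -> q \in A ->
  p \in priv y -> q \in priv y -> p != q -> y \in B -> c y = 1 ->
  2 < c p \/ 2 < c q.
Proof.
move=> gc yA pA qA pP qP npq yB cy; have [c0 cP] := gc.
have := good_neq gc yA pA yB (priv_adj cl pP).
have := good_neq gc yA qA yB (priv_adj cl qP).
rewrite cy; have := c0 p pA; have := c0 q qA => q0 p0 q1 p1.
have : ~ (c p = 2 /\ c q = 2).
  move=> [p2 q2]; have := cP p q pA qA npq; rewrite p2 q2 => /(_ erefl)[[]//|[_]].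
  by case/privP: pP => _; case/privP: qP => _; rewrite /sep => -> ->; rewrite eqxx !andbF.
by move: q0 p0 q1 p1; clear; lia.
Qed.

(** The colour of [p] is used only once, so [y] may take it. Every neighbour of [p] other than [y]
    is also a neighbour of [y], hence not coloured 1, so [p] may take colour 1. *)
Lemma good_swap_priv A k c y p : good A k c -> y \in A -> p \in A ->
  p \in priv y -> y \in B -> c y = 1 -> 2 < c p ->
  good A k (fun v => if v == y then c p else if v == p then c y else c v).
Proof.
move=> gc yA pA pP yB cy p2; have [pB hp] := privP pP.
apply: good_swap => //; rewrite ?cy; first by move: p2; clear; lia.
  move=> v vA nvy nvp cv; left; split=> //; apply/negP => epv.
  have hv := side_adj cl pB epv; suff eyv : e y v.
    by have := good_neq gc yA vA yB eyv; rewrite cv cy eqxx.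
  have [vB|vB] := boolP (v \in B).
    by move: nvy; rewrite -(home_id cl vB) -hv hp eqxx.
  by have := home_adj cl vB; rewrite -hv hp.
move=> v vA nvy nvp cv; case: (good_big gc pA vA nvp p2 cv).
Qed.

(** A core vertex [w] of colour 2 is alone in its class. Then neither of the adjacent vertices [p]
    and [q] has colour 2 and at most one has colour 1, so one has a colour above 2 and can be
    exchanged with [w]. Class 1 stays as it is, and the only newcomer to class 2 has home [z]. *)
Lemma good_side2 A k c z p q : good A k c -> p \in A -> q \in A ->
  p \in priv z -> q \in priv z -> e p q ->
  exists c', [/\ good A k c', forall v, v \in A -> c' v = 2 -> v \notin B,
    forall v, (c' v == 1) = (c v == 1) &
    forall v, v \in A -> c' v = 2 -> c v = 2 \/ h v = z].
Proof.
move=> gc pA qA pP qP epq; have [c0 cP] := gc.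
have [/existsP[w /and3P[wA wB /eqP cw]]|] :=
  boolP [exists w, [&& w \in A, w \in B & c w == 2]]; last first.
  move/existsPn => no2; exists c; split=> // v vA cv; last by left.
  by have := no2 v; rewrite vA cv eqxx andbT.
have only2 v : v \in A -> v != w -> c v != 2.
  move=> vA nvw; apply/eqP => cv; have := cP w v wA vA.
  by rewrite eq_sym nvw cw cv => /(_ isT erefl)[[]|[_]] //; rewrite /sep wB.
have [pB hp] := privP pP; have [qB hq] := privP qP.
have [r [rA rB hr r2]] : exists r, [/\ r \in A, r \notin B, h r = z & 2 < c r].
  have np := core_notin wB pB; have nq := core_notin wB qB.
  have := only2 p pA; have := only2 q qA; rewrite ![_ == w]eq_sym np nq.
  move=> /(_ isT) q2 /(_ isT) p2; have := c0 p pA; have := c0 q qA => q0 p0.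
  have [p1|p1] := eqVneq (c p) 1.
    exists q; split=> //; suff : c q != 1 by move: q0 q2; clear; lia.
    apply/eqP => q1; have := cP p q pA qA (adj_neq cl epq).
    by rewrite p1 q1 /compat epq => /(_ erefl)[[]|[]].
  by exists p; split=> //; move: p0 p1 p2; clear; lia.
have nrw := core_notin wB rB.
exists (fun v => if v == w then c r else if v == r then c w else c v); split.
- apply: good_swap => // [|v vA nvw nvr cv|v vA nvw nvr cv]; first by rewrite cw neq_ltn r2.
    by move: (only2 v vA nvw); rewrite cv cw.
  by case: (good_big gc rA vA nvr r2 cv).
- move=> v vA; have [_ cr|nvw] := eqVneq v w; first by rewrite cr in r2.
  by have [->//|_ cv] := eqVneq v r; have := only2 v vA nvw; rewrite cv.
- move=> v; have [->|_] := eqVneq v w; first by rewrite cw !gtn_eqF ?(ltnW r2).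
  by have [->|//] := eqVneq v r; rewrite cw !gtn_eqF ?(ltnW r2).
- move=> v vA; have [_ cr|nvw] := eqVneq v w; first by rewrite cr in r2.
  by have [-> _|_ ->] := eqVneq v r; [right | left].
Qed.

Definition deletion_saves := forall a b, e a b ->
  exists2 k, packing_colorable (del_edge e a b) setT k
           & ~~ packing_colorable e setT k.

Hypothesis crit : deletion_saves.

(** Scheme of the lemmas below. The end [v0] of the deleted edge is home to no other vertex, so no
    route between other vertices through their homes uses it, and a colouring of the smaller graph
    is already good away from [v0]. Repairing it at [v0] contradicts criticality. *)
Lemma edge_needed a b v0 : e a b -> (v0 == a) || (v0 == b) ->
  (forall u, u != v0 -> h u != v0) ->
  (forall k c, packing (del_edge e a b) setT k c -> good (setT :\ v0) k c ->
     exists c', good setT k c') -> False.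
Proof.
move=> eab v0ab hv0 recol; have [k /packing_colorableP[c cP]] := crit eab.
case/negP; apply/good_colorableP; apply: (recol k c cP).
have keep u v : e u v -> u != v0 -> v != v0 -> del_edge e a b u v.
  move=> euv nu nv; apply: del_edge_neq => //.
  by case/orP: v0ab => /eqP<-; rewrite nu nv ?orbT.
have cP' : packing (del_edge e a b) (setT :\ v0) k c.
  by apply: packing_sub cP; rewrite ?subsetT.
apply: packing_good cP' _ _ _ => [u v|v|u v]; rewrite !inE !andbT.
- by move=> nu nv _ _ euv; apply: keep.
- move=> nv vB; have ehv := home_adj cl vB.
  by split; apply: keep; rewrite ?hv0 // sym_e.
- move=> nu nv nh; apply: keep; rewrite ?hv0 //.
  by apply: (core_clique cl); rewrite ?(home_in cl).
Qed.

Lemma priv_home x l : l \in priv x -> forall u, u != l -> h u != l.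
Proof. by case/privP=> lB _ u _; rewrite core_notin // (home_in cl). Qed.

Lemma leaf_extend k c x l : x \in B -> l \in priv x -> lone l ->
  good (setT :\ l) k c -> c x != 1 -> exists c', good setT k c'.
Proof.
move=> xB lP ll gc cx; have [lB hl] := privP lP.
have [c0 _] := gc; have xA : x \in setT :\ l by rewrite !inE core_notin.
exists (fun v => if v == l then 1 else c v); apply: good_set => //.
  by have := c0 x xA; clear; lia.
move=> v _ cv; left; split=> //; apply/negP => elv.
have [vB|vB] := boolP (v \in B); last by rewrite (loneP ll vB) in elv.
by move: cx; rewrite -hl (side_adj cl lB elv) (home_id cl vB) cv.
Qed.

(** If the home has colour 1, one of two further private vertices has a colour above 2; exchanging
    it with the home frees colour 1 for the leaf. *)
Lemma leaf_with_two_others y l : y \in B -> l \in priv y -> lone l ->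
  2 < #|priv y| -> False.
Proof.
move=> yB lP ll P3; have [lB hl] := privP lP.
have yA : y \in setT :\ l by rewrite !inE core_notin.
have /card_gt1P[p [q [/setD1P[pl pP] /setD1P[ql qP] npq]]] : 1 < #|priv y :\ l|.
  by move: P3; rewrite (cardsD1 l) lP.
apply: (edge_needed (priv_adj cl lP) (v0 := l)); rewrite ?eqxx ?orbT //.
  exact: priv_home lP.
move=> k c _ gc; have [cy|] := eqVneq (c y) 1; last exact: leaf_extend gc.
have pA : p \in setT :\ l by rewrite !inE pl.
have qA : q \in setT :\ l by rewrite !inE ql.
have [p3|q3] := priv_colour3 gc yA pA qA pP qP npq yB cy.
  have := good_swap_priv gc yA pA pP yB cy p3.
  by move/(leaf_extend yB lP ll); apply; rewrite eqxx gtn_eqF // ltnW.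
have := good_swap_priv gc yA qA qP yB cy q3.
by move/(leaf_extend yB lP ll); apply; rewrite eqxx gtn_eqF // ltnW.
Qed.

(** The hard case has colours 1 and 2 on [y] and [p]. Every other vertex of these colours then lies
    outside the core, where nothing is adjacent: the two classes merge into colour 1, [y] takes
    colour 2, and the leaf joins colour 1. *)
Lemma two_leaves_no_side_edge y : (forall v, v \notin B -> lone v) -> y \in B ->
  1 < #|priv y| -> False.
Proof.
move=> all yB /card_gt1P[l [p [lP pP nlp]]]; have [lB hl] := privP lP.
have [pB hp] := privP pP; have ll := all l lB.
have yA : y \in setT :\ l by rewrite !inE core_notin.
have pA : p \in setT :\ l by rewrite !inE eq_sym nlp.
apply: (edge_needed (priv_adj cl lP) (v0 := l)); rewrite ?eqxx ?orbT //.
  exact: priv_home lP.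
move=> k c _ gc; have [cy|] := eqVneq (c y) 1; last exact: leaf_extend gc.
have [c0 cP] := gc.
have cp1 := good_neq gc yA pA yB (priv_adj cl pP); rewrite cy in cp1.
have [cp|cp2] := eqVneq (c p) 2; last first.
  have p3 : 2 < c p by move: (c0 p pA) cp1 cp2; clear; lia.
  have := good_swap_priv gc yA pA pP yB cy p3.
  by move/(leaf_extend yB lP ll); apply; rewrite eqxx gtn_eqF // ltnW.
have side v : v \in setT :\ l -> v != y -> (c v == 1) || (c v == 2) -> v \notin B.
  move=> vA nvy /orP[]/eqP cv; apply/negP => vB.
    have eyv : e y v by apply: (core_clique cl); rewrite // eq_sym.
    by have := good_neq gc yA vA yB eyv; rewrite cv cy.
  have := cP v p vA pA (core_notin vB pB); rewrite cv cp => /(_ erefl).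
  by case=> [[]|[_]] //; rewrite /sep vB.
suff : good (setT :\ l) k (fun v => if v == y then 2 else if c v == 2 then 1 else c v).
  by move/(leaf_extend yB lP ll); apply; rewrite eqxx.
have k2 : 2 <= k by have := c0 p pA; rewrite cp => /andP[].
split=> [v vA|u v uA vA nuv].
  case: eqP => _; first by rewrite k2.
  by case: eqP => _; [exact: ltnW | apply: c0].
have [uy|nuy] := eqVneq u y; have [vy|nvy] := eqVneq v y.
- by rewrite uy vy eqxx in nuv.
- by case: eqP => // nv /esym.
- by case: eqP.
have [/andP[u12 v12] _|nuv12] :=
  boolP (((c u == 1) || (c u == 2)) && ((c v == 1) || (c v == 2))).
  left; split; first by case/orP: u12 => /eqP->.
  by rewrite loneP ?(side v) //; apply/all/side.
move=> cuv; have cuv' : c u = c v.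
  move: nuv12 cuv; case: (eqVneq (c u) 2) => [->|]; case: (eqVneq (c v) 2) => [->|];
    by clear; lia.
have [[E _]|[E _]] := cP u v uA vA nuv cuv'; move: nuv12; rewrite -cuv' E //.
Qed.

(** A core vertex without private vertices has only core neighbours, so it can take over colour 1
    from the home [y] of the leaf. Its own colour is not 1 and sits on a core vertex, hence is used
    once and may pass to [y]. *)
Lemma bare_and_leaf x l : x \in B -> priv x = set0 -> l \notin B -> lone l -> False.
Proof.
move=> xB Px lB ll; pose y := h l.
have yB : y \in B := home_in cl l.
have lP : l \in priv y by rewrite in_priv lB eqxx.
have nyx : y != x.
  by apply/eqP => yx; have := in_set0 l; rewrite -Px -yx lP.
have yA : y \in setT :\ l by rewrite !inE core_notin.
have xA : x \in setT :\ l by rewrite !inE core_notin.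
apply: (edge_needed (priv_adj cl lP) (v0 := l)); rewrite ?eqxx ?orbT //.
  exact: priv_home lP.
move=> k c _ gc; have [cy|] := eqVneq (c y) 1; last exact: leaf_extend gc.
have eyB v : v \in B -> v != y -> e y v.
  by move=> vB nv; apply: (core_clique cl); rewrite // eq_sym.
have cxy : c y != c x by apply: good_neq gc _ _ _ (eyB _ _ _); rewrite // eq_sym.
suff : good (setT :\ l) k (fun v => if v == y then c x else if v == x then c y else c v).
  by move/(leaf_extend yB lP ll); apply; rewrite eqxx -cy eq_sym.
apply: good_swap => // v vA nvy nvx cv.
  rewrite cy; left; split=> //; apply/negP => exv.
  have vB : v \in B.
    apply/negPn/negP => vB; have := in_set0 v.
    by rewrite -Px in_priv vB (core_adj cl xB vB exv) eqxx.
  by have := good_neq gc yA vA yB (eyB v vB nvy); rewrite cv eqxx.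
have [_ cP] := gc; case: (cP v x vA xA nvx cv) => [[]|[_]].
  by rewrite cv -cy => E; rewrite E eqxx in cxy.
by rewrite sep_sym /sep xB.
Qed.

(** If [x] has colour 1, the leaf takes colour 2: the side edge serves to clear the core of that
    colour, and [x] has no other private vertex that could hold it. *)
Lemma single_leaf_and_side_edge x l z p q : x \in B -> priv x = [set l] ->
  p \in priv z -> q \in priv z -> e p q -> False.
Proof.
move=> xB Px pP qP epq.
have lP : l \in priv x by rewrite Px set11.
have [lB hl] := privP lP; have [pB hp] := privP pP; have [qB hq] := privP qP.
have ll : lone l.
  apply/forallP => w; apply/implyP => wB; apply/negP => elw.
  have : w \in priv x by rewrite in_priv wB -(side_adj cl lB elw) hl eqxx.
  by rewrite Px => /set1P wl; rewrite wl (cl_irr cl) in elw.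
have pA : p \in setT :\ l.
  by rewrite !inE andbT; apply: contraTneq epq => ->; rewrite loneP.
have qA : q \in setT :\ l.
  by rewrite !inE andbT; apply: contraTneq epq => ->; rewrite sym_e loneP.
have xA : x \in setT :\ l by rewrite !inE core_notin.
apply: (edge_needed (priv_adj cl lP) (v0 := l)); rewrite ?eqxx ?orbT //.
  exact: priv_home lP.
move=> k c _ gc; have [cx|] := eqVneq (c x) 1; last exact: leaf_extend gc.
have [c' [gc' no2 _ _]] := good_side2 gc pA qA pP qP epq.
exists (fun v => if v == l then 2 else c' v); apply: good_set => //.
  have [y yB nyx] := core_other cl x; have yA : y \in setT :\ l by rewrite !inE core_notin.
  have := good_neq gc xA yA xB; rewrite (core_clique cl) // 1?eq_sym // => /(_ isT).
  by rewrite cx; case: gc => /(_ y yA); clear; lia.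
move=> v vA cv; right; split=> //; have vB := no2 v vA cv; rewrite /sep lB vB hl.
apply/eqP => hv; have : v \in priv x by rewrite in_priv vB hv eqxx.
by rewrite Px => /set1P vl; rewrite vl !inE eqxx in vA.
Qed.

(** Without the edge from [p] to [q] the only possible conflict is colour 1 on both. Then [q]
    switches to 2, after the other side edge has cleared the core of it; as that edge lies at [z]
    and not at [y], no vertex at [y] has received colour 2. *)
Lemma lone_triangle_and_side_edge y p q z r s : y \in B -> priv y = [set p; q] ->
  e p q -> z != y -> r \in priv z -> s \in priv z -> e r s -> False.
Proof.
move=> yB Py epq nzy rP sP ers.
have pP : p \in priv y by rewrite Py !inE eqxx.
have qP : q \in priv y by rewrite Py !inE eqxx orbT.
have [pB hp] := privP pP; have [qB hq] := privP qP.
have npq := adj_neq cl epq.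
apply: (edge_needed epq (v0 := q)); rewrite ?eqxx ?orbT //.
  exact: priv_home qP.
move=> k c cP gc.
have [/andP[/eqP cp /eqP cq]|n11] := boolP ((c p == 1) && (c q == 1)); last first.
  exists c; apply: packing_good cP _ _ _ => [u v _ _ cu cv euv|v _ vB|u v _ _ nh].
  - apply/negPn/negP => /(del_edgeN euv) E; case/negP: n11.
    by case: E => -[<- <-]; rewrite cu cv.
  - have ehv := home_adj cl vB; have hvB := home_in cl v.
    have nvpq : (v != p) || (v != q) by have [->|//] := eqVneq v p.
    split; apply: del_edge_neq; rewrite // 1?sym_e // (core_notin hvB pB);
      by rewrite (core_notin hvB qB) ?andbT.
  - apply: del_edge_neq; first by apply: (core_clique cl); rewrite ?(home_in cl).
    by rewrite !core_notin // (home_in cl).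
have nA w x : w \in priv x -> x != y -> w \in setT :\ q.
  move=> wP nxy; rewrite !inE andbT; apply: contraNneq nxy => wq.
  by case/privP: wP => _ <-; rewrite wq hq.
have [c' [gc' no2 _ old2]] := good_side2 gc (nA _ _ rP nzy) (nA _ _ sP nzy) rP sP ers.
exists (fun v => if v == q then 2 else c' v); apply: good_set => //.
  have pA : p \in setT :\ q by rewrite !inE npq.
  have yA : y \in setT :\ q by rewrite !inE core_notin.
  have := good_neq gc yA pA yB (priv_adj cl pP).
  by rewrite cp; case: gc => /(_ y yA); clear; lia.
move=> v vA cv; right; split=> //; have vB := no2 v vA cv; rewrite /sep qB vB hq.
apply/eqP => hv; have : v \in priv y by rewrite in_priv vB hv eqxx.
rewrite Py => /set2P[vp|vq]; last by rewrite vq !inE eqxx in vA.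
case: (old2 v vA cv) => [|hz]; first by rewrite vp cp.
by rewrite hv hz eqxx in nzy.
Qed.

(** The deleted edge joins the bare vertex [x] to [y]. Seen from [x] this only moves [y] to distance
    2 and [priv y] to distance 3, so the conflicts to repair are colour 1 on [x] and [y], and colour
    2 on [x] and in [priv y]. The cluster of [y] settles the first, the edge at [z] the second. *)
Lemma bare_and_side_edges x y z p q r s : x \in B -> priv x = set0 -> y != z ->
  p \in priv y -> q \in priv y -> e p q ->
  r \in priv z -> s \in priv z -> e r s -> False.
Proof.
move=> xB Px nyz pP qP epq rP sP ers.
have [pB hp] := privP pP; have [qB hq] := privP qP.
have [rB hr] := privP rP; have [sB hs] := privP sP.
have yB : y \in B by rewrite -hp (home_in cl).
have zB : z \in B by rewrite -hr (home_in cl).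
have nx w t : w \in priv t -> t != x.
  by move=> wP; apply/eqP => tx; have := in_set0 w; rewrite -Px -tx wP.
have nyx := nx _ _ pP; have nzx := nx _ _ rP.
have nxy : x != y by rewrite eq_sym.
have nzy : z != y by rewrite eq_sym.
have nxz : x != z by rewrite eq_sym.
have nxA v : v != x -> v \in setT :\ x by rewrite !inE => ->.
have nhx v : v != x -> h v != x.
  have [vB|vB] := boolP (v \in B); first by rewrite (home_id cl vB).
  by move=> _; apply: (nx v); rewrite in_priv vB eqxx.
have exB v : e x v -> v \in B.
  move=> exv; apply/negPn/negP => vB.
  by have := nhx v; rewrite eq_sym core_notin // (core_adj cl xB vB exv) eqxx => /(_ isT).
have eB u v : u \in B -> v \in B -> u != v -> e u v by exact: core_clique cl u v.
have exy : e x y by rewrite eB // eq_sym.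
apply: (edge_needed exy (v0 := x)); rewrite ?eqxx //.
move=> k c cP gc.
have sA v : v \notin B -> v \in setT :\ x by move=> vB; apply: nxA; rewrite eq_sym core_notin.
have yA := nxA y nyx.
have [/andP[/eqP cx /eqP cy]|n11] := boolP ((c x == 1) && (c y == 1)).
  have [w [wP w3]] : exists w, w \in priv y /\ 2 < c w.
    have := priv_colour3 gc yA (sA p pB) (sA q qB) pP qP (adj_neq cl epq) yB cy.
    by case; [exists p | exists q].
  have [wB _] := privP wP.
  have gc' := good_swap_priv gc yA (sA w wB) wP yB cy w3.
  eexists; apply: (good_set (q := x) (i := 1) gc'); first by case: gc => /(_ y yA); clear; lia.
  move=> v vA cv; left; split=> //; apply/negP => exv; have vB := exB v exv.
  move: cv; case: eqP => [_|/eqP nvy]; first by move=> E; rewrite E in w3.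
  case: eqP => [vw|_ cv]; first by rewrite -vw vB in wB.
  by have := good_neq gc yA vA yB; rewrite cv cy eB // 1?eq_sym // => /(_ isT).
pose E := del_edge e x y.
have keep u v : e u v -> (u != x) && (v != x) || (u != y) && (v != y) -> E u v.
  exact: del_edge_neq.
have near v : v != x -> ~~ (v \in priv y) -> v \in ball E 2 x.
  move=> nvx vP; have [vy|nvy] := eqVneq v y.
    apply: (@ball_step _ _ _ _ z).
      apply/ball1P; right; apply: keep; first exact: eB.
      by rewrite nxy nzy orbT.
    by rewrite vy; apply/orP; right; apply: keep; [exact: eB | rewrite nzx nyx].
  have hvB := home_in cl v.
  have hvy : h v != y.
    have [vB|vB] := boolP (v \in B); first by rewrite (home_id cl vB).
    by move: vP; rewrite in_priv vB.
  apply: (@ball_step _ _ _ _ (h v)).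
    apply/ball1P; right; apply: keep; first by rewrite eB // eq_sym nhx.
    by rewrite nxy hvy orbT.
  have [vB|vB] := boolP (v \in B); first by rewrite (home_id cl vB) eqxx.
  by apply/orP; right; apply: keep; [exact: home_adj cl _ vB | rewrite nhx ?nvx].
have [_ far] := cP.
(* In this conflict colour 2 occurs only on [x] and in [priv y], so a vertex [t] at [z] can change
   to it and leave its own colour to [x]. *)
have [/andP[/eqP cx /exists_inP[w wP /eqP cw]]|n22] :=
  boolP ((c x == 2) && [exists w in priv y, c w == 2]).
  have only2 v : v \in setT :\ x -> c v = 2 -> v \in priv y.
    rewrite !inE andbT => nvx cv; apply/negPn/negP => vP.
    have := far x v; rewrite !inE cx cv eq_sym nvx => /(_ isT isT isT erefl).
    by rewrite near // in_priv.
  have [t [tB ht t3]] : exists t, [/\ t \notin B, h t = z & 2 < c t].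
    have [c0 cP'] := gc.
    have n2 t : t \notin B -> h t = z -> c t != 2.
      move=> tB ht; apply/eqP => /(only2 t (sA t tB)) /privP[_ hy].
      by rewrite -hy ht eqxx in nyz.
    have := n2 r rB hr; have := n2 s sB hs.
    have := c0 r (sA r rB); have := c0 s (sA s sB) => s0 r0 s2 r2.
    have [r1|r1] := eqVneq (c r) 1; last by exists r; split=> //; move: r0 r1 r2; clear; lia.
    exists s; split=> //; suff : c s != 1 by move: s0 s2; clear; lia.
    apply/eqP => s1; have := cP' r s (sA r rB) (sA s sB) (adj_neq cl ers).
    by rewrite r1 s1 /compat ers => /(_ erefl)[[]|[]].
  have tA := sA t tB; have [c0 _] := gc.
  have gc' : good (setT :\ x) k (fun v => if v == t then 2 else c v).
    apply: good_set; first by apply: good_sub gc; apply: subD1set.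
      by move: (c0 t tA) t3; clear; lia.
    move=> v /setD1P[_ vA] cv; right; split=> //.
    by have [vB hv] := privP (only2 v vA cv); rewrite /sep tB vB ht hv eq_sym nyz.
  exists (fun v => if v == x then c t else if v == t then 2 else c v).
  apply: good_set => //; first exact: c0.
  move=> v vA; case: eqP => [_|/eqP nvt cv]; first by move=> t2; rewrite -t2 in t3.
  by case: (good_big gc tA vA nvt t3 cv).
exists (fun v => if v == x then c x else c v); apply: good_set => //.
  by case: cP => /(_ x (in_setT x)).
move=> v vA cv; have nvx : v != x by case/setD1P: vA.
have := far x v; rewrite !inE cv eq_sym nvx => /(_ isT isT isT erefl) nv.
case ci : (c x) nv => [|[|[|i]]].
- by case: cP => /(_ x (in_setT x)); rewrite ci.
- move=> nv; left; split=> //; apply/negP => exv; case/negP: nv.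
  apply/ball1P; right; apply: keep => //.
  rewrite nxy orbC; apply/orP; left.
  by apply: contraNneq n11 => vy; rewrite -vy cv ci.
- case/negP; apply: near => //; apply: contra n22 => vP; rewrite ci eqxx /=.
  by apply/exists_inP; exists v; rewrite // cv ci.
- case/negP; apply: (@ball_le _ _ 3) => //.
  have [vP|vP] := boolP (v \in priv y); last by apply: ball_le (near v nvx vP).
  apply: (@ball_step _ _ _ _ y); last first.
    by apply/orP; right; apply: keep; [apply: (priv_adj cl) | rewrite nyx nvx].
  by apply: near => //; rewrite in_priv yB.
Qed.

(** Without side edges every cluster must be a single leaf, which is (a). With a side edge every
    cluster has at least two vertices and is free of leaves or a pair of leaves. A leaf-free cluster
    of size two excludes side edges elsewhere, which separates (b) from (c). *)
Lemma critical_cond : block_graph e -> is_block e B ->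
  [\/ condA e B, condB e B | condC e B].
Proof.
move=> bg bB.
have P0P x : ~~ (0 < #|priv x|) -> priv x = set0.
  by rewrite -leqNgt leqn0 cards_eq0 => /eqP.
have [/forallP all|] := boolP [forall v, (v \notin B) ==> lone v].
  have all' v : v \notin B -> lone v by apply/implyP/all.
  constructor 1; apply/(condAP cl) => x xB; apply/eqP.
  have : ~~ (1 < #|priv x|) by apply/negP => /(two_leaves_no_side_edge all' xB).
  have : 0 < #|priv x|; last by clear; lia.
  apply/negPn/negP => /P0P Px; have [l lB _] := priv_other cl x.
  exact: bare_and_leaf xB Px lB (all' l lB).
rewrite negb_forall => /existsP[p]; rewrite negb_imply => /andP[pB].
case/nloneP=> q qB epq.
have pP : p \in priv (h p) by rewrite in_priv pB eqxx.
have qP : q \in priv (h p) by rewrite in_priv qB (side_adj cl pB epq) eqxx.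
have type x : x \in B -> 1 < #|priv x| /\
    ((forall v, v \in priv x -> ~~ lone v) \/
     (#|priv x| = 2 /\ forall v, v \in priv x -> lone v)).
  move=> xB.
  have P1 : 0 < #|priv x|.
    apply/negPn/negP => /P0P Px.
    have [/existsP[l /andP[lB ll]]|/existsPn nl] :=
      boolP [exists l, (l \notin B) && lone l].
      exact: bare_and_leaf xB Px lB ll.
    have [r rB nr] := priv_other cl (h p).
    have /nloneP[s sB ers] : ~~ lone r by have := nl r; rewrite rB.
    rewrite eq_sym in nr.
    apply: (bare_and_side_edges xB Px nr pP qP epq _ _ ers).
      by rewrite in_priv rB eqxx.
    by rewrite in_priv sB (side_adj cl rB ers) eqxx.
  have P2 : 1 < #|priv x|.
    rewrite ltn_neqAle P1 andbT eq_sym; apply/negP => /cards1P[l Px].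
    exact: single_leaf_and_side_edge xB Px pP qP epq.
  split=> //; have [/exists_inP[l lP ll]|/exists_inPn] :=
    boolP [exists l in priv x, lone l]; last by left.
  right; have E2 : #|priv x| = 2.
    apply/eqP; rewrite eqn_leq P2 andbT leqNgt; apply/negP.
    exact: leaf_with_two_others xB lP ll.
  split=> // v vP; have [->//|nvl] := eqVneq v l.
  have Px : priv x = [set v; l].
    apply/eqP; rewrite eq_sym eqEcard cards2 nvl E2 andbT.
    by apply/subsetP => w /set2P[]->.
  apply/forallP => w; apply/implyP => wB; apply/negP => evw.
  have [vB hv] := privP vP.
  have : w \in priv x by rewrite in_priv wB -(side_adj cl vB evw) hv eqxx.
  rewrite Px => /set2P[] wE; first by rewrite wE (cl_irr cl) in evw.
  by rewrite wE sym_e loneP in evw.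
have nlE x : x \in B -> (forall v, v \in priv x -> ~~ lone v) ->
    exists u v, [/\ u \in priv x, v \in priv x & e u v].
  move=> xB nl; have [/ltnW/card_gt0P[u uP] _] := type x xB.
  have [uB hu] := privP uP; have /nloneP[v vB euv] := nl u uP.
  by exists u, v; rewrite in_priv uB in_priv vB -(side_adj cl uB euv) hu eqxx.
have nle x : (forall v, v \in priv x -> ~~ lone v) <-> [forall v in priv x, ~~ lone v].
  by split=> [?|/forall_inP]; first exact/forall_inP.
have [/existsP[y /and3P[yB /nle nl /eqP y2]]|/existsPn ny] := boolP
  [exists y, [&& y \in B, [forall v in priv y, ~~ lone v] & #|priv y| == 2]].
  constructor 2; apply/(condBP cl); exists y; split=> // x xB nxy.
  have [_ [nlx|//]] := type x xB.
  have [r [s [rP sP ers]]] := nlE x xB nlx.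
  have [u [v [uP vP euv]]] := nlE y yB nl.
  case: (lone_triangle_and_side_edge (p := u) (q := v) yB _ euv nxy rP sP ers).
  apply/eqP; rewrite eq_sym eqEcard cards2 (adj_neq cl euv) y2 andbT.
  by apply/subsetP => w /set2P[]->.
have c12 x : x \in B -> (forall v, v \in priv x -> ~~ lone v) -> c1 e B x \/ c2 e B x.
  move=> xB nlx; apply/(c12P cl bg bB xB); split.
    exact/eqP/(no_leaf_nbrP cl xB).
  have [x2 _] := type x xB; have := ny x; rewrite xB (introT idP (proj1 (nle x) nlx)) /=.
  by move: x2; clear; lia.
constructor 3; split=> [x xB|].
  have [_ [/(c12 x xB)[]|/(c3P cl xB)]] := type x xB;
    by [constructor 1 | constructor 2 | constructor 3].
exists (h p); split; first exact: home_in cl p.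
have [_ [/(c12 _ (home_in cl p))//|[_ /(_ p pP)/loneP/(_ qB)]]] := type _ (home_in cl p).
by rewrite epq.
Qed.

End Recolouring.

(** * Sufficiency: colourings from labellings, and case (a) *)

Lemma label_colorable (T : finType) (E : rel T) (lab : T -> nat) r k :
  (forall v, lab v <= r) ->
  (forall u v, u != v -> lab u = lab v -> lab u != 0 -> v \notin ball E (lab u) u) ->
  #|[set v | lab v == 0]| + r <= k -> packing_colorable E setT k.
Proof.
move=> labr labP; set Z := [set v | _] => Zk.
apply/packing_colorableP.
(* Label 0 stands for no shared class: such a vertex gets a colour of its own above [r], given by
   its rank in [Z]. *)
exists (fun v => if lab v == 0 then r.+1 + index v (enum Z) else lab v).
have Zi v : lab v = 0 -> v \in enum Z by move=> v0; rewrite mem_enum inE v0.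
split=> [v _|u v _ _ nuv].
  case: eqP => [/Zi vZ|/eqP v0]; last by move: (labr v) v0 Zk; clear; lia.
  by move: vZ; rewrite -index_mem -cardE; move: Zk; clear; lia.
have := labr u; have := labr v; case: eqP => [/Zi uZ|/eqP u0]; case: eqP => [/Zi vZ|/eqP v0].
- move=> _ _ /addnI/esym E1; case/eqP: nuv; apply: esym; exact: index_inj uZ E1.
- by move=> vr _ E1; move: vr; rewrite -E1; clear; lia.
- by move=> _ ur E1; move: ur; rewrite E1; clear; lia.
- by move=> _ _ uv; apply: labP.
Qed.

Section Savings.
Variables (T : finType) (e : rel T) (B : {set T}) (h : T -> T).
Hypothesis cl : clustered e B h.

Let sym_e : symmetric e := cl_sym cl.

Notation priv := (priv B h).
Notation lone := (lone e B).
Notation core_notin := (@core_notin T B).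
Notation sep := (sep B h).
Notation good := (good e B h).

Definition saves a b := exists2 k,
  packing_colorable (del_edge e a b) setT k & ~~ packing_colorable e setT k.

Lemma saves_sym a b : saves a b -> saves b a.
Proof.
move=> [k /packing_colorableP[c cP] nk]; exists k => //.
apply/packing_colorableP; exists c; apply: packing_sub cP => // u v.
by rewrite /del_edge /= -!andbA => /and3P[-> -> ->].
Qed.

Lemma deletion_saves_edges :
  (forall x y, x \in B -> y \in B -> x != y -> saves x y) ->
  (forall x p, x \in B -> p \in priv x -> saves x p) ->
  (forall x p q, x \in B -> p \in priv x -> q \in priv x -> e p q -> saves p q) ->
  deletion_saves e.
Proof.
move=> core leg side a b eab.
have [aB|aB] := boolP (a \in B); have [bB|bB] := boolP (b \in B).
- exact: core (adj_neq cl eab).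
- by apply: leg; rewrite // in_priv bB (core_adj cl aB bB eab) eqxx.
- rewrite sym_e in eab; apply: saves_sym; apply: leg => //.
  by rewrite in_priv aB (core_adj cl bB aB eab) eqxx.
- apply: (side (h a)); rewrite ?(home_in cl) // in_priv ?aB ?bB ?eqxx //.
  by rewrite (side_adj cl aB eab) eqxx.
Qed.

Lemma condA_saves : (forall x, x \in B -> #|priv x| = 1) -> deletion_saves e.
Proof.
move=> P1; have m1 := card_core cl.
have uniq u v : u \notin B -> v \notin B -> h u = h v -> u = v.
  move=> uB vB huv; have /eqP/cards1P[w wE] := P1 (h u) (home_in cl u).
  have : u \in priv (h u) by rewrite in_priv uB eqxx.
  have : v \in priv (h u) by rewrite in_priv vB huv eqxx.
  by rewrite wE => /set1P-> /set1P->.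
have side0 u v : u \notin B -> v \notin B -> e u v = false.
  move=> uB vB; apply/negP => euv; have := adj_neq cl euv.
  by rewrite (uniq u v uB vB (side_adj cl uB euv)) eqxx.
have low : ~~ packing_colorable e setT #|B|.
  apply/negP => /(good_colorableP cl)[c gc]; have [c0 cP] := gc.
  have inT v : v \in [set: T] by [].
  have cE v : (inord (c v) : 'I_#|B|.+1) = c v :> nat.
    by rewrite inordK // ltnS; case/andP: (c0 v (inT v)).
  have inj : {in B &, injective (fun v => inord (c v) : 'I_#|B|.+1)}.
    move=> u v uB vB /(congr1 val) /=; rewrite !cE => cuv; apply/eqP.
    apply: contraTT isT => nuv.
    by have := good_neq cl gc (inT u) (inT v) uB (core_clique cl uB vB nuv); rewrite cuv eqxx.
  have im : [set (inord (c v) : 'I_#|B|.+1) | v in B] = [set~ ord0].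
    apply/eqP; rewrite eqEcard card_in_imset // cardsC1 card_ord leqnn andbT.
    apply/subsetP => _ /imsetP[v vB ->]; rewrite !inE -val_eqE /= cE -lt0n.
    by case/andP: (c0 v (inT v)).
  have hit j : 0 < j <= #|B| -> exists2 x, x \in B & c x = j.
    move=> /andP[j0 jB]; have : (inord j : 'I_#|B|.+1) \in [set~ ord0].
      by rewrite !inE -val_eqE /= inordK // -lt0n.
    rewrite -im => /imsetP[x xB /(congr1 val) /=]; rewrite cE inordK // => ->.
    by exists x.
  have [x xB cx] := hit 1 (ltnW m1); have [z zB cz] := hit 2 m1.
  have /card_gt0P[l lP] : 0 < #|priv x| by rewrite P1.
  have [lB hl] := privP lP.
  have l1 := good_neq cl gc (inT x) (inT l) xB (priv_adj cl lP).
  have l2 : c l != 2.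
    apply/eqP => cl2; have := cP z l (inT z) (inT l) (core_notin zB lB).
    by rewrite cz cl2 => /(_ erefl)[[]|[_]] //; rewrite /sep zB.
  have l3 : 2 < c l by move: (c0 l (inT l)) l1 l2; rewrite cx; clear; lia.
  have [w wB cw] := hit (c l) (c0 l (inT l)).
  exact: (good_big gc (inT l) (inT w) (core_notin wB lB) l3 cw).
(* Labels 1 and 2 that miss only the [#|B| - 2] core vertices other than [x] and [y] give a
   colouring with [#|B|] colours. *)
have done (lab : T -> nat) a b x y : x \in B -> y \in B -> x != y ->
    (forall v, lab v <= 2) -> (forall v, lab v = 0 -> v \in B /\ v != x /\ v != y) ->
    (forall u v, u != v -> lab u = 1 -> lab v = 1 -> ~~ del_edge e a b u v) ->
    (forall u v, u != v -> lab u = 2 -> lab v = 2 -> sep u v) -> saves a b.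
  move=> xB yB nxy lab2 lab0 V1 V2; exists #|B| => //.
  apply: (@label_colorable _ _ lab 2) => [//|u v nuv luv|].
    have := lab2 u; case lu : (lab u) luv => [|[|[|?]]] // /esym lv _ _.
      by apply/ball1P => -[vu|]; [rewrite vu eqxx in nuv | apply/negP/V1].
    apply: contra (sep_far cl (V2 u v nuv lu lv)).
    by apply: ball_mono; apply: del_edge_sub.
  have : #|[set v | lab v == 0]| <= #|B :\ x :\ y|.
    apply: subset_leq_card; apply/subsetP => v; rewrite !inE => /eqP/lab0[-> [-> ->]].
    by [].
  have := cardsD1 y (B :\ x); have := cardsD1 x B.
  by rewrite xB !inE eq_sym nxy yB /=; clear; lia.
apply: deletion_saves_edges => [x y xB yB nxy|x l xB lP|x p q xB pP qP epq].
(* Without the edge, [x] and [y] share label 1 with all leaves away from them; the two leaves at [x]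
   and [y] have distinct homes and share label 2. *)
- pose lab v := if v \in B then if (v == x) || (v == y) then 1 else 0 else
    if (h v == x) || (h v == y) then 2 else 1.
  apply: (done lab) nxy _ _ _ _ => // [v|v|u v nuv|u v nuv]; rewrite /lab.
  + by do 2!case: ifP.
  + case: ifP => vB; last by case: ifP.
    by case: ifP => // /negbT; rewrite negb_or => /andP[-> ->].
  + have [uB|uB] := boolP (u \in B); have [vB|vB] := boolP (v \in B).
    * case: ifP => // uxy _; case: ifP => // vxy _.
      rewrite /del_edge /=; move: nuv; case/orP: uxy => /eqP->; case/orP: vxy => /eqP->;
        by rewrite eqxx // ?andbF.
    * case: ifP => // uxy _; case: ifP => // vxy _.
      apply/negP => /del_edge_sub /(core_adj cl uB vB) hv.
      by rewrite hv uxy in vxy.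
    * case: ifP => // uxy _; case: ifP => // vxy _.
      apply/negP => /del_edge_sub; rewrite sym_e => /(core_adj cl vB uB) hv.
      by rewrite hv vxy in uxy.
    * by move=> _ _; apply/negP => /del_edge_sub; rewrite side0.
  + have [uB|uB] := boolP (u \in B); first by case: (_ || _).
    have [vB|vB] := boolP (v \in B); first by move=> _; case: (_ || _).
    move=> _ _; rewrite /sep uB vB; apply: contra nuv => /eqP huv.
    exact/eqP/uniq.
- have [y yB nyx] := core_other cl x.
  (* With the leg cut, [x] joins all side vertices in label 1, and [y] alone has label 2. *)
  pose lab v := if v == x then 1 else if v == y then 2 else (v \notin B : nat).
  have nxy : x != y by rewrite eq_sym.
  have [lB hl] := privP lP.
  have xside v : v \notin B -> del_edge e x l x v = false.
    move=> vB; apply/negP => H; have exv := del_edge_sub H.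
    have vl : v = l by apply: uniq => //; rewrite (core_adj cl xB vB exv).
    by move: H; rewrite vl /del_edge /= eqxx andbF.
  have lab1 v : lab v = 1 -> v = x \/ v \notin B.
    by rewrite /lab; case: eqP => [->|_]; [left | case: ifP => // _; case: (v \in B); right].
  apply: (done lab) nxy _ _ _ _ => // [v|v|u v nuv|u v nuv].
  + by rewrite /lab; do 2!case: ifP => // _; case: (v \in B).
  + by rewrite /lab; do 2!case: eqP => // _; case: (v \in B).
  + case/lab1=> [ux|uB] /lab1[vx|vB]; rewrite ?ux ?vx.
    * by rewrite ux vx eqxx in nuv.
    * by rewrite xside.
    * by rewrite del_edge_sym // xside.
    * by apply/negP => /del_edge_sub; rewrite side0.
  + have lab2 w : lab w = 2 -> w = y.
      by rewrite /lab; do 2!case: eqP => // _; case: (w \in B).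
    by move=> /lab2 uy /lab2 vy; rewrite uy vy eqxx in nuv.
- have [pB _] := privP pP; have [qB _] := privP qP.
  by rewrite side0 in epq.
Qed.

End Savings.

(** * Sufficiency in cases (b) and (c) *)

Section HeavyClusters.
Variables (T : finType) (e : rel T) (B : {set T}) (h : T -> T).
Hypothesis cl : clustered e B h.

Let sym_e : symmetric e := cl_sym cl.

Notation priv := (priv B h).
Notation lone := (lone e B).
Notation core_notin := (@core_notin T B).
Notation loneP := (@loneP T e B).
Notation sep := (sep B h).
Notation good := (good e B h).
Notation saves := (saves e).

Definition side_indep (I : {set T}) :=
  [forall u in I, (u \notin B) && [forall v in I, ~~ e u v]].

Lemma side_indepP (I : {set T}) :
  reflect ((forall u, u \in I -> u \notin B) /\
           forall u v, u \in I -> v \in I -> e u v = false)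
          (side_indep I).
Proof.
apply: (iffP forall_inP) => [H|[IB Ie] u uI].
  split=> [u /H/andP[]//|u v /H/andP[_ /forall_inP uI] vI].
  by rewrite (negPf (uI v vI)).
by rewrite IB //; apply/forall_inP => v vI; rewrite Ie.
Qed.

Definition side_max (R : {set T}) := side_indep R /\
  forall v, v \notin B -> v \notin R -> exists2 w, w \in R & e v w.

Lemma side_max_exists (Q : {set T}) : side_indep Q ->
  exists2 R, side_max R & Q \subset R.
Proof.
move=> /maxset_exists[R /maxsetP[iR maxR] QR]; exists R => //; split=> // v vB vR.
apply/exists_inP; apply: contraNT vR => /exists_inPn none.
rewrite -(maxR (v |: R)) ?setU11 ?subsetUr //.
have [RB Re] := side_indepP _ iR.
apply/side_indepP; split=> [u /setU1P[->//|]|]; first exact: RB.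
move=> u w /setU1P[->|uR] /setU1P[->|wR]; rewrite ?(cl_irr cl) //.
- by rewrite (negPf (none w wR)).
- by rewrite sym_e (negPf (none u uR)).
- exact: Re.
Qed.

(** The side vertices induce a disjoint union of cliques, and a maximal independent set takes one
    vertex from each. The map [f] sends a vertex of [I] to the representative of its clique in
    [R]. *)
Lemma side_indep_card R I : side_max R -> side_indep I -> #|I| <= #|R|.
Proof.
move=> [iR maxR] /side_indepP[IB Ie]; have [RB Re] := side_indepP _ iR.
pose f v := if v \in R then v else odflt v [pick w in R | e v w].
have fP v : v \in I -> f v \in R /\ (v = f v \/ e v (f v)).
  move=> vI; rewrite /f; have [vR|vR] := boolP (v \in R); first by split; last left.
  case: pickP => [w /andP[]|none]; first by split; last right.
  by have [w wR evw] := maxR v (IB v vI) vR; have := none w; rewrite wR evw.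
rewrite -(card_in_imset (f := f)).
  by apply: subset_leq_card; apply/subsetP => _ /imsetP[v /fP[vR _] ->].
move=> u v uI vI fuv; have [fuR fu] := fP u uI; have [_ fv] := fP v vI.
rewrite -fuv in fv; case: fu fv => [fu|fu] [fv|fv].
- by rewrite fu fv.
- by rewrite -fu sym_e Ie in fv.
- by rewrite -fv Ie in fu.
- apply/eqP; apply: contraTT isT => nuv; have := Ie u v uI vI.
  rewrite (side_trans cl (IB _ uI) (RB _ fuR) (IB _ vI) fu) //.
  by rewrite sym_e.
Qed.

Definition heavy : {set T} := [set x in B | [forall v in priv x, ~~ lone v]].

Lemma heavyP x :
  reflect (x \in B /\ forall v, v \in priv x -> ~~ lone v) (x \in heavy).
Proof.
rewrite inE; apply: (iffP andP) => -[xB]; first by move/forall_inP.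
by move=> H; split=> //; apply/forall_inP.
Qed.

(** These hypotheses treat (b) and (c) together: in (b) there is one heavy vertex, with two private
    vertices; in (c) every heavy vertex has at least three, so [thin_heavy] holds vacuously. *)
Hypothesis core_type : forall x, x \in B -> 1 < #|priv x| /\
  (x \in heavy \/ (#|priv x| = 2 /\ forall v, v \in priv x -> lone v)).
Hypothesis heavy0 : 0 < #|heavy|.
Hypothesis thin_heavy : forall x, x \in heavy -> #|priv x| = 2 -> heavy = [set x].

Lemma nlone_heavy v : v \notin B -> ~~ lone v -> h v \in heavy.
Proof.
move=> vB nl; have [_ [//|[_ all]]] := core_type (home_in cl v).
by rewrite all // in_priv vB eqxx in nl.
Qed.

(** Once a swap has cleared the core of colour 1, the leaves coloured 2 can be counted with colour 1
    in the independent set [J]. The rest of colour 2 is a single core vertex, or consists of side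
    vertices with distinct heavy homes. Each colour above 2 occurs at most once. *)
Lemma colour_lower R k : side_max R -> packing_colorable e setT k ->
  #|T| + 2 <= k + #|R| + #|heavy|.
Proof.
move=> Rmax /(good_colorableP cl)[c1 gc1].
have inT v : v \in [set: T] by [].
have [c [gc noB]] : exists c, good setT k c /\ forall x, x \in B -> c x != 1.
  have [/existsP[x /andP[xB /eqP cx]]|/existsPn no1] :=
    boolP [exists x, (x \in B) && (c1 x == 1)]; last first.
    by exists c1; split=> // x xB; have := no1 x; rewrite xB.
  have [/card_gt1P[p [q [pP qP npq]]] _] := core_type xB.
  have [r [rP r3]] : exists r, r \in priv x /\ 2 < c1 r.
    have := priv_colour3 cl gc1 (inT x) (inT p) (inT q) pP qP npq xB cx.
    by case; [exists p | exists q].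
  have [rB _] := privP rP.
  eexists; split; first exact: (good_swap_priv cl gc1 (inT x) (inT r) rP xB cx r3).
  move=> y yB /=; have [_|nyx] := eqVneq y x; first by move: r3; clear; lia.
  rewrite (negPf (core_notin yB rB)) -cx eq_sym.
  by apply: (good_neq cl gc1); rewrite // (core_clique cl) // eq_sym.
have [c0 cP] := gc.
pose J := [set v | (c v == 1) || [&& c v == 2, v \notin B & lone v]].
pose I2 := [set v | (c v == 2) && ~~ ((v \notin B) && lone v)].
pose D := [set v | 2 < c v].
have JB u : u \in J -> u \notin B.
  rewrite inE => /orP[/eqP cu|/and3P[]//]; apply/negP => uB.
  by have := noB u uB; rewrite cu.
have JR : #|J| <= #|R|.
  apply: side_indep_card => //; apply/side_indepP; split=> [|u v uJ vJ]; first exact: JB.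
  apply/negP => euv; have uB := JB u uJ; have vB := JB v vJ; rewrite !inE in uJ vJ.
  case/orP: uJ => [/eqP cu|/and3P[_ _ lu]]; last by rewrite loneP in euv.
  case/orP: vJ => [/eqP cv|/and3P[_ _ lv]]; last by rewrite sym_e loneP in euv.
  have := cP u v (inT u) (inT v) (adj_neq cl euv).
  by rewrite cu cv /compat euv => /(_ erefl)[[]|[]].
have two u v : c u = 2 -> c v = 2 -> u != v -> sep u v.
  move=> cu cv nuv; have := cP u v (inT u) (inT v) nuv; rewrite cu cv.
  by move=> /(_ erefl)[[]|[]].
have I2g : #|I2| <= #|heavy|.
  have [/existsP[w /andP[wI wB]]|/existsPn noI] := boolP [exists w, (w \in I2) && (w \in B)].
    apply: leq_trans heavy0; rewrite -(cards1 w); apply: subset_leq_card.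
    apply/subsetP => v; rewrite !inE in wI *; case/andP: wI => /eqP cw _ /andP[/eqP cv _].
    apply/negPn/negP => nvw; have := two w v cw cv; rewrite eq_sym nvw /sep wB.
    by move=> /(_ isT).
  have I2B v : v \in I2 -> v \notin B by move=> vI; have := noI v; rewrite vI.
  rewrite -(card_in_imset (f := h)).
    apply: subset_leq_card; apply/subsetP => _ /imsetP[v vI ->].
    have vB := I2B v vI; apply: nlone_heavy => //.
    by move: vI; rewrite inE vB => /andP[].
  move=> u v; rewrite !inE => /andP[/eqP cu _] /andP[/eqP cv _] huv.
  apply/eqP; apply: contraTT isT => nuv; have := two u v cu cv nuv.
  by rewrite /sep huv eqxx !andbF.
have k2 : 2 <= k.
  have /card_gt0P[x xB] : 0 < #|B| by apply: ltnW; exact: card_core cl.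
  by move: (c0 x (inT x)) (noB x xB); clear; lia.
have Dk : #|D| <= k - 2.
  rewrite cardE -(size_map c) -(size_iota 3 (k - 2)); apply: uniq_leq_size.
    rewrite map_inj_in_uniq ?enum_uniq // => u v; rewrite !mem_enum !inE => u2 v2 cuv.
    apply/eqP; apply: contraTT isT => nuv.
    by have := good_big gc (inT v) (inT u) nuv v2 cuv.
  move=> _ /mapP[v vD ->]; move: vD; rewrite mem_enum inE mem_iota.
  by move: (c0 v (inT v)) k2; clear; lia.
have : #|T| <= #|J :|: I2 :|: D|.
  rewrite -cardsT; apply: subset_leq_card; apply/subsetP => v _; rewrite !inE.
  have := c0 v (inT v); case: (c v) => [|[|[|n]]] //= _.
  by rewrite orbF; case: (_ && _).
have := leq_card_setU (J :|: I2) D; have := leq_card_setU J I2.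
by move=> [+ _] [+ _]; move: JR I2g Dk k2; clear; lia.
Qed.

(** Colour 1 on [R] and colour 2 on the image of [heavy] under [t] attain the bound
    [#|R| + #|heavy|] for the first two colours. *)
Definition spare (R : {set T}) (t : T -> T) :=
  forall x, x \in heavy -> t x \in priv x /\ t x \notin R.

(** The vertices [u1] and [u2] are those gained over the optimal classes of the whole graph.
    Relabelling inside these classes is allowed as long as all labels there remain nonzero. *)
Lemma saves_by_label R t a b u1 u2 lab : side_max R -> spare R t ->
  u1 != u2 -> u1 \notin R :|: t @: heavy -> u2 \notin R :|: t @: heavy ->
  (forall v, lab v <= 3) ->
  (forall v, v \in R :|: t @: heavy -> lab v != 0) -> lab u1 != 0 -> lab u2 != 0 ->
  (forall u v, u != v -> lab u = 1 -> lab v = 1 -> ~~ del_edge e a b u v) ->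
  (forall u v, u != v -> lab u = 2 -> lab v = 2 -> sep u v) ->
  (forall u v, u != v -> lab u = 3 -> lab v = 3 ->
     v \notin ball (del_edge e a b) 3 u) ->
  saves a b.
Proof.
move=> Rmax tP nu u1S u2S lab3 labS l1 l2 V1 V2 V3.
have cS : #|R :|: t @: heavy| = #|R| + #|heavy|.
  rewrite cardsU disjoint_setI0 ?cards0 ?subn0 ?card_in_imset //.
    move=> x y xH yH txy; have [/privP[_ <-] _] := tP x xH.
    by have [/privP[_ <-] _] := tP y yH; rewrite txy.
  rewrite disjoint_sym disjoint_subset; apply/subsetP => _ /imsetP[x xH ->].
  by have [_] := tP x xH; rewrite inE.
have cU : #|u1 |: (u2 |: (R :|: t @: heavy))| = #|R| + #|heavy| + 2.
  rewrite !cardsU1 !inE in u1S u2S *; rewrite -in_setU cS.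
  by rewrite in_setU negb_or nu (negPf u1S) u2S; clear; lia.
have : #|u1 |: (u2 |: (R :|: t @: heavy))| <= #|[set v | lab v != 0]|.
  apply: subset_leq_card; apply/subsetP => v; rewrite [_ \in [set _ | _]]inE.
  by case/setU1P=> [->//|/setU1P[->//|]]; apply: labS.
rewrite cU => le; have cT : #|[set v | lab v == 0]| + #|[set v | lab v != 0]| = #|T|.
  rewrite -(cardsC [set v | lab v == 0]); congr addn.
  by apply: eq_card => v; rewrite !inE.
(* Three colours, and one for each of at most [#|T| - (#|R| + #|heavy| + 2)] unlabelled vertices:
   one below the bound of [colour_lower]. *)
exists (#|T|.+1 - (#|R| + #|heavy|)); last first.
  by apply/negP => /(colour_lower Rmax); move: le cT; clear; lia.
apply: (@label_colorable _ _ lab 3) => [//|u v nuv luv|]; last first.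
  by move: le cT; clear; lia.
have := lab3 u; case lu : (lab u) luv => [|[|[|[|?]]]] // /esym lv _ _.
- by apply/ball1P => -[vu|]; [rewrite vu eqxx in nuv | apply/negP/V1].
- apply: contra (sep_far cl (V2 u v nuv lu lv)).
  by apply: ball_mono; apply: del_edge_sub.
- exact: V3.
Qed.

(** A private vertex in [R] has a neighbour in its cluster outside [R]. If [b] were the only private
    vertex outside [R], at least two others would lie in [R] and be adjacent to [b], hence to each
    other. *)
Lemma heavy_spare R x b : side_indep R -> x \in heavy ->
  b \notin priv x \/ #|priv x| != 2 ->
  exists v, [/\ v \in priv x, v \notin R & v != b].
Proof.
move=> /side_indepP[RB Re] /heavyP[xB nl] bx.
have nbr u : u \in priv x -> u \in R -> exists v, [/\ v \in priv x, v \notin R & e u v].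
  move=> uP uR; have /nloneP[v vB euv] := nl u uP; have [uB hu] := privP uP.
  exists v; split=> //; first by rewrite in_priv vB -(side_adj cl uB euv) hu eqxx.
  by apply/negP => vR; rewrite Re in euv.
have [P2 _] := core_type xB.
have [bP|bP] := boolP (b \in priv x); last first.
  have /card_gt0P[u uP] : 0 < #|priv x| by apply: ltnW.
  have [uR|uR] := boolP (u \in R); last first.
    by exists u; split=> //; apply: contraNneq bP => <-.
  have [v [vP vR _]] := nbr u uP uR.
  by exists v; split=> //; apply: contraNneq bP => <-.
have {bx P2} P3 : 2 < #|priv x|.
  by case: bx => [|nx]; [rewrite bP | move: nx P2; clear; lia].
have [/existsP[v /and3P[]]|/existsPn none] :=
  boolP [exists v, [&& v \in priv x, v \notin R & v != b]]; first by exists v.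
have /card_gt1P[u [v [/setD1P[ub uP] /setD1P[vb vP] nuv]]] : 1 < #|priv x :\ b|.
  by move: P3; rewrite (cardsD1 b) bP; clear; lia.
have inR w : w \in priv x -> w != b -> w \in R.
  by move=> wP wb; have := none w; rewrite wP wb andbT negbK.
have tob w : w \in priv x -> w != b -> e w b.
  move=> wP wb; have [w' [w'P w'R eww']] := nbr w wP (inR w wP wb).
  by have := none w'; rewrite w'P w'R negbK => /eqP<-.
have [bB _] := privP bP; have [uB _] := privP uP; have [vB _] := privP vP.
have := Re u v (inR u uP ub) (inR v vP vb).
by rewrite (side_trans cl uB bB vB (tob u uP ub)) // sym_e tob.
Qed.

Lemma spare_exists R b : side_indep R -> (forall x, x \in heavy ->
    b \notin priv x \/ #|priv x| != 2) ->
  exists2 t, spare R t & forall x, x \in heavy -> t x != b.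
Proof.
move=> iR bP.
pose t x := odflt x [pick v | [&& v \in priv x, v \notin R & v != b]].
have tP x : x \in heavy -> [&& t x \in priv x, t x \notin R & t x != b].
  move=> xH; rewrite /t; case: pickP => [//|none].
  have [v [vP vR vb]] := heavy_spare iR xH (bP x xH).
  by have := none v; rewrite vP vR vb.
by exists t => x /tP/and3P[].
Qed.

Lemma spare_inj R t x y : spare R t -> x \in heavy -> t x \in priv y -> x = y.
Proof. by move=> tP /tP[/privP[_ hx] _] /privP[_ <-]. Qed.

(* A cluster that can absorb one vertex labelled 3: either a further private
   vertex [r] gets the label, or the cluster has just two private vertices, and
   they get 2 and 3 while their home gets 1. *)
Definition absorbs3 (R : {set T}) (t : T -> T) x r := r \in priv x /\
  ((r \in R /\ #|priv x| = 2) \/ (r \notin R /\ r \notin t @: heavy)).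

Lemma absorbs3_exists R t x : side_max R -> spare R t -> x \in B ->
  exists r, absorbs3 R t x r.
Proof.
move=> [iR maxR] tP xB; have [P2 ty] := core_type xB.
have [E2|n2] := eqVneq #|priv x| 2.
  have /card_gt0P[u uP] : 0 < #|priv x| by apply: ltnW.
  have [uR|uR] := boolP (u \in R); first by exists u; split=> //; left.
  have [uB hu] := privP uP; have [w wR euw] := maxR u uB uR.
  have [RB _] := side_indepP _ iR.
  exists w; split; last by left.
  by rewrite in_priv RB // -(side_adj cl uB euw) hu eqxx.
case: ty => [xH|[E2 _]]; last by rewrite E2 in n2.
have [r [rP rR rt]] := heavy_spare (b := t x) iR xH (or_intror n2).
exists r; split=> //; right; split=> //; apply/imsetP => -[y yH ry].
by move: rt; rewrite ry -(spare_inj tP yH (y := x)) ?eqxx // -ry.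
Qed.

(** The deletion lets [r] and [s] share label 3. Each of the two clusters gains one vertex: [r]
    itself if it was unlabelled, otherwise the home [x], which can take label 1 because [r] gives it
    up and the other private vertex gets 2; likewise for [s] and [y]. *)
Lemma saves_by_absorption R t a b x y r s : side_max R -> spare R t ->
  x \in B -> y \in B -> x != y -> absorbs3 R t x r -> absorbs3 R t y s ->
  (r \in R -> s \in R -> ~~ del_edge e a b x y) ->
  s \notin ball (del_edge e a b) 3 r -> r \notin ball (del_edge e a b) 3 s ->
  saves a b.
Proof.
move=> Rmax tP xB yB nxy [rP rA] [sP sA] nE far_rs far_sr.
have [iR _] := Rmax; have [RB Re] := side_indepP _ iR.
have [rB hr] := privP rP; have [sB hs] := privP sP.
have nrs : r != s by apply: contraNneq nxy => rs; rewrite -hr rs hs.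
pose S := R :|: t @: heavy.
have SB v : v \in S -> v \notin B.
  by case/setUP=> [/RB//|/imsetP[w /tP[/privP[wB _] _] ->]].
(* The homes that take label 1; the rest of their clusters, one vertex each, gets label 2. *)
pose top v := (v == x) && (r \in R) || (v == y) && (s \in R).
pose lab v := if (v == r) || (v == s) then 3 else
  if v \in B then top v : nat else
  if top (h v) then 2 else
  if v \in R then 1 else if v \in t @: heavy then 2 else 0.
have labB v : v \in B -> lab v = top v.
  move=> vB; rewrite /lab vB.
  by rewrite (negPf (core_notin vB rB)) (negPf (core_notin vB sB)).
have lab3 v : lab v = 3 -> v = r \/ v = s.
  rewrite /lab; case: ifP => [/orP[]/eqP|_]; [by left | by right |].
  by case: ifP => _; [case: (top v) | do 3!case: ifP => //].
have lab2 v : lab v = 2 -> [/\ v \notin B, v != r, v != s &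
    top (h v) \/ (~~ top (h v) /\ v \in t @: heavy)].
  rewrite /lab; case: ifP => // /negbT; rewrite negb_or => /andP[nr ns].
  case: ifP => [_|/negbT vB]; first by case: (top v).
  case: ifP => [tv _|/negbT tv]; first by split=> //; left.
  case: ifP => // _; case: ifP => // vt _; split=> //; right; split=> //.
have lab1 v : lab v = 1 -> (v \in B /\ top v) \/
    [/\ v \notin B, ~~ top (h v) & v \in R].
  rewrite /lab; case: ifP => // _.
  case: ifP => [vB|/negbT vB]; first by case tv: (top v) => // _; left.
  case: ifP => // /negbT tv; case: ifP => [vR _|_]; first by right.
  by case: ifP.
pose u x r := if r \in R then x else r.
have uS z q : z \in B -> q \in priv z -> absorbs3 R t z q -> u z q \notin S.
  move=> zB qP [_ qA]; rewrite /u; case: ifP => [_|qR].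
    by apply/negP => /SB; rewrite zB.
  by case: qA => [[]|[_ qt]]; rewrite ?qR // in_setU qR.
have topE v : top v -> v = x /\ r \in R \/ v = y /\ s \in R.
  by case/orP=> /andP[/eqP-> ?]; [left | right].
apply: (@saves_by_label R t a b (u x r) (u y s) lab Rmax tP).
- rewrite /u; case: ifP => _; case: ifP => _ //; first exact: core_notin.
  by rewrite eq_sym core_notin.
- by apply: uS => //; split.
- by apply: uS => //; split.
- move=> v; rewrite /lab; do 2!case: ifP => // _; first by case: (top v).
  by do 3!case: ifP => // _.
- move=> v vS; rewrite /lab; case: ifP => // _.
  rewrite (negPf (SB v vS)); case: ifP => // _.
  by case/setUP: vS => [->//|->]; case: ifP.
- rewrite /u; case: ifP => rR; last by rewrite /lab eqxx.
  by rewrite labB // /top eqxx rR.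
- rewrite /u; case: ifP => sR; last by rewrite /lab eqxx orbT.
  by rewrite labB // /top eqxx sR orbT.
- have xy v w : v \in B -> w \in B -> v != w -> top v -> top w -> ~~ del_edge e a b v w.
    move=> vB wB nvw /topE tv /topE tw; move: nvw.
    case: tv tw => -[-> vR] [] [-> wR]; rewrite ?eqxx // => _; first exact: nE.
    by rewrite del_edge_sym //; apply: nE.
  have xs v w : v \in B -> top v -> w \notin B -> ~~ top (h w) -> ~~ e v w.
    move=> vB tv wB; apply: contra => /(core_adj cl vB wB)->.
    exact: tv.
  move=> v w nvw /lab1[[vB tv]|[vB tv vR]] /lab1[[wB tw]|[wB tw wR]].
  + exact: xy.
  + by apply: contra (xs v w vB tv wB tw); apply: del_edge_sub.
  + rewrite del_edge_sym //.
    by apply: contra (xs w v wB tw vB tv); apply: del_edge_sub.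
  + by apply/negP => /del_edge_sub; rewrite Re.
- have one z q v w : q \in priv z -> #|priv z| = 2 -> v \in priv z -> w \in priv z ->
      v != q -> w != q -> v = w.
    move=> qP P2 vP wP vq wq; have : #|priv z :\ q| == 1.
      by move: P2; rewrite (cardsD1 q) qP; clear; lia.
    case/cards1P=> z' zE.
    have : v \in priv z :\ q by rewrite !inE vq -in_priv.
    have : w \in priv z :\ q by rewrite !inE wq -in_priv.
    by rewrite zE => /set1P-> /set1P->.
  move=> v w nvw /lab2[vB vr vs vA] /lab2[wB wr ws wA].
  rewrite /sep vB wB; apply/eqP => hvw; case/eqP: nvw.
  have vP : v \in priv (h v) by rewrite in_priv vB eqxx.
  have wP : w \in priv (h v) by rewrite in_priv wB hvw eqxx.
  rewrite -hvw in wA; case: vA wA => [tv|[tv vt]] [tw|[tw wt]].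
  + case: (topE _ tv) => -[hv qR]; rewrite hv in vP wP.
      by case: rA => [[_ P2]|[]]; [apply: (one x r) | rewrite qR].
    by case: sA => [[_ P2]|[]]; [apply: (one y s) | rewrite qR].
  + by rewrite tv in tw.
  + by rewrite tw in tv.
  + case/imsetP: vt => v' vH vE; case/imsetP: wt => w' wH wE.
    have := spare_inj (y := h v) tP vH; rewrite -vE => /(_ vP) v'E.
    have := spare_inj (y := h v) tP wH; rewrite -wE => /(_ wP) w'E.
    by rewrite vE wE v'E w'E.
- move=> v w nvw /lab3[]vE /lab3[]wE; first by case/eqP: nvw; rewrite vE wE.
  + by rewrite vE wE; exact: far_rs.
  + by rewrite vE wE; exact: far_sr.
  + by case/eqP: nvw; rewrite vE wE.
Qed.

(* In a cluster with two private vertices [p] and [q], cutting [p] off from its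
   home [x] allows the labels 1, 1, 2 on [x], [p], [q]. *)
Lemma thin_leg_saves x p : x \in B -> p \in priv x -> #|priv x| = 2 -> saves x p.
Proof.
move=> xB pP P2; have [pB hp] := privP pP.
have [R Rmax pR] : exists2 R, side_max R & p \in R.
  have [|R Rmax] := @side_max_exists [set p].
    apply/side_indepP; split=> [u /set1P->//|u v /set1P-> /set1P->].
    exact: cl_irr cl p.
  by rewrite sub1set; exists R.
have [iR _] := Rmax; have [RB Re] := side_indepP _ iR.
have [|t tP _] := @spare_exists R x iR.
  by move=> z _; left; rewrite in_priv xB.
have [y yB nyx] := core_other cl x.
have [q qP nqp] : exists2 q, q \in priv x & q != p.
  have /card_gt0P[q /setD1P[]] : 0 < #|priv x :\ p|; last by exists q.
  by move: P2; rewrite (cardsD1 p) pP; clear; lia.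
have [qB hq] := privP qP.
have pq v : v \in priv x -> v = p \/ v = q.
  have -> : priv x = [set p; q]; last by case/set2P; [left | right].
  apply/eqP; rewrite eq_sym eqEcard cards2 eq_sym nqp P2 andbT.
  by apply/subsetP => w /set2P[]->.
have SB v : v \in R :|: t @: heavy -> v \notin B.
  by case/setUP=> [/RB//|/imsetP[w /tP[/privP[wB _] _] ->]].
(* The gained vertices are [x], which joins label 1 beside the detached [p], and the core vertex
   [y], alone in label 3. *)
pose lab v := if v == y then 3 else if v == x then 1 else if v == q then 2 else
  if v \in R then 1 else if v \in t @: heavy then 2 else 0.
have lab3 v : lab v = 3 -> v = y.
  by rewrite /lab; case: eqP => [//|_]; do 4!case: ifP => // _.
have lab2 v : lab v = 2 -> v = q \/ v \in t @: heavy.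
  rewrite /lab; do 2!case: ifP => // _; case: eqP => [|_]; first by left.
  by do 2!case: ifP => // _; right.
have lab1 v : lab v = 1 -> v = x \/ v \in R /\ v != q.
  rewrite /lab; case: ifP => // _; case: eqP => [|_]; first by left.
  by case: eqVneq => // nvq; case: ifP => [vR _|_]; [right | case: ifP].
apply: (@saves_by_label R t x p x y lab Rmax tP).
- by rewrite eq_sym.
- by apply/negP => /SB; rewrite xB.
- by apply/negP => /SB; rewrite yB.
- by move=> v; rewrite /lab; do 5!case: ifP => // _.
- move=> v vS; rewrite /lab; do 3!case: ifP => // _.
  by case/setUP: vS => [->//|->]; case: ifP.
- by rewrite /lab eqxx; case: ifP.
- by rewrite /lab eqxx.
- have xR v : v \in R -> v != q -> ~~ del_edge e x p x v.
    move=> vR nvq; apply/negP => H; have exv := del_edge_sub H.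
    have vP : v \in priv x by rewrite in_priv RB // (core_adj cl xB (RB v vR) exv) eqxx.
    case: (pq v vP) => vE; last by rewrite vE eqxx in nvq.
    by move: H; rewrite vE /del_edge /= eqxx andbF.
  move=> u v nuv /lab1[ux|[uR nuq]] /lab1[vx|[vR nvq]].
  + by rewrite ux vx eqxx in nuv.
  + by rewrite ux; apply: xR.
  + by rewrite vx del_edge_sym //; apply: xR.
  + by apply/negP => /del_edge_sub; rewrite Re.
- have tx z : z \in heavy -> h (t z) = x -> t z = q.
    move=> zH hz; have [/privP[tB _] tR] := tP z zH.
    have /pq[tp|//] : t z \in priv x by rewrite in_priv tB hz eqxx.
    by rewrite tp pR in tR.
  move=> u v nuv lu lv; have side w : lab w = 2 -> w \notin B.
    by case/lab2=> [->//|wt]; apply: SB; rewrite in_setU wt orbT.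
  rewrite /sep !side //; apply: contra nuv => /eqP huv; apply/eqP.
  case/lab2: lu huv => [->|/imsetP[u' uH ->]]; case/lab2: lv => [->|/imsetP[v' vH ->]] //.
  + by rewrite hq => /esym/(tx v' vH).
  + by rewrite hq => /(tx u' uH).
  + by have [/privP[_ ->] _] := tP u' uH; have [/privP[_ ->] _] := tP v' vH => ->.
- by move=> u v nuv /lab3 uy /lab3 vy; case/eqP: nuv; rewrite uy vy.
Qed.

(** With [p] in [R], cutting the edge lets [q] join label 1. In a large cluster [t] can avoid [q],
    so [q] is one gain, and any core vertex [y] with label 3 is the other. In a cluster of two, [q]
    is the spare vertex itself; its move frees label 2 for [x], the only heavy vertex. *)
Lemma side_edge_saves x p q : x \in B -> p \in priv x -> q \in priv x -> e p q ->
  saves p q.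
Proof.
move=> xB pP qP epq; have [pB hp] := privP pP; have [qB hq] := privP qP.
have xH : x \in heavy.
  by rewrite -hp; apply: nlone_heavy => //; apply/nloneP; exists q.
have [R Rmax pR] : exists2 R, side_max R & p \in R.
  have [|R Rmax] := @side_max_exists [set p].
    apply/side_indepP; split=> [u /set1P->//|u v /set1P-> /set1P->].
    exact: cl_irr cl p.
  by rewrite sub1set; exists R.
have [iR _] := Rmax; have [RB Re] := side_indepP _ iR.
have [y yB nyx] := core_other cl x.
have qR : q \notin R by apply/negP => qR; rewrite Re in epq.
have Rq v : v \in R -> ~~ del_edge e p q q v.
  move=> vR; apply/negP => H; have eqv := del_edge_sub H.
  have [vp|nvp] := eqVneq v p.
    by move: H; rewrite vp /del_edge /= eqxx !andbF.
  have : e p v by apply: (side_trans cl pB qB (RB v vR) epq); rewrite // eq_sym.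
  by rewrite Re.
have V1 u v : u != v -> u \in q |: R -> v \in q |: R -> ~~ del_edge e p q u v.
  move=> nuv /setU1P[uq|uR] /setU1P[vq|vR].
  - by rewrite uq vq eqxx in nuv.
  - by rewrite uq; apply: Rq.
  - by rewrite vq del_edge_sym //; apply: Rq.
  - by apply/negP => /del_edge_sub; rewrite Re.
have [P2|P3] := eqVneq #|priv x| 2.
  have HE := thin_heavy xH P2.
  have [|t tP _] := @spare_exists R x iR.
    by move=> z _; left; rewrite in_priv xB.
  have SB v : v \in R :|: t @: heavy -> v \notin B.
    by case/setUP=> [/RB//|/imsetP[w /tP[/privP[wB _] _] ->]].
  have tq v : v \in t @: heavy -> v = q.
    case/imsetP=> z zH ->; have [tzP tzR] := tP z zH.
    move: zH; rewrite HE => /set1P zx; rewrite zx in tzP tzR *.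
    apply/eqP; apply: contraTT isT => nq.
    have : [set p; q; t x] \subset priv x.
      by apply/subsetP => w; rewrite !inE -orbA -in_priv => /or3P[]/eqP->.
    move/subset_leq_card; rewrite P2 setUC cardsU1 cards2 (adj_neq cl epq) !inE.
    by rewrite (negPf nq) orbF; case: eqP => // tp; rewrite tp pR in tzR.
  pose lab v := if v == x then 2 else if v == y then 3 else (v \in q |: R : nat).
  have lab1 v : lab v = 1 -> v \in q |: R.
    by rewrite /lab; do 2!case: ifP => // _; case: (v \in _).
  have lab2 v : lab v = 2 -> v = x.
    by rewrite /lab; case: eqP => // _; case: ifP => // _; case: (v \in _).
  have lab3 v : lab v = 3 -> v = y.
    by rewrite /lab; case: ifP => // _; case: eqP => // _; case: (v \in _).
  apply: (@saves_by_label R t p q x y lab Rmax tP).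
  - by rewrite eq_sym.
  - by apply/negP => /SB; rewrite xB.
  - by apply/negP => /SB; rewrite yB.
  - by move=> v; rewrite /lab; do 2!case: ifP => // _; case: (v \in _).
  - move=> v vS; rewrite /lab; do 2!case: ifP => // _.
    have -> // : v \in q |: R.
    by case/setUP: vS => [vR|/tq->]; rewrite !inE ?vR ?eqxx ?orbT.
  - by rewrite /lab eqxx.
  - by rewrite /lab eqxx; case: ifP.
  - by move=> u v nuv /lab1 uL /lab1 vL; apply: V1.
  - by move=> u v nuv /lab2 ux /lab2 vx; rewrite ux vx eqxx in nuv.
  - by move=> u v nuv /lab3 uy /lab3 vy; case/eqP: nuv; rewrite uy vy.
have [|t tP tq] := @spare_exists R q iR.
  move=> z zH; have [zx|nzx] := eqVneq z x; first by right; rewrite zx.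
  by left; rewrite in_priv hq eq_sym (negPf nzx) andbF.
have SB v : v \in R :|: t @: heavy -> v \notin B.
  by case/setUP=> [/RB//|/imsetP[w /tP[/privP[wB _] _] ->]].
have qt : q \notin t @: heavy.
  by apply/imsetP => -[z zH qE]; have := tq z zH; rewrite -qE eqxx.
pose lab v := if v == y then 3 else if v \in q |: R then 1 else
  if v \in t @: heavy then 2 else 0.
have lab1 v : lab v = 1 -> v \in q |: R.
  by rewrite /lab; case: ifP => // _; case: ifP => // _; case: ifP.
have lab2 v : lab v = 2 -> v \in t @: heavy.
  by rewrite /lab; do 3!case: ifP => //.
have lab3 v : lab v = 3 -> v = y.
  by rewrite /lab; case: eqP => // _; do 2!case: ifP => // _.
apply: (@saves_by_label R t p q q y lab Rmax tP).
- by rewrite eq_sym core_notin.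
- by rewrite in_setU negb_or qR.
- by apply/negP => /SB; rewrite yB.
- by move=> v; rewrite /lab; do 3!case: ifP => // _.
- move=> v vS; rewrite /lab; case: ifP => // _; case: ifP => // /negbT.
  rewrite in_setU1 negb_or => /andP[_ vR].
  by case/setUP: vS => [|->//]; rewrite (negPf vR).
- by rewrite /lab setU11; case: ifP.
- by rewrite /lab eqxx.
- by move=> u v nuv /lab1 uL /lab1 vL; apply: V1.
- move=> u v nuv /lab2/imsetP[u' uH uE] /lab2/imsetP[v' vH vE].
  have [/privP[uB hu] _] := tP u' uH; have [/privP[vB hv] _] := tP v' vH.
  rewrite uE vE in nuv *; rewrite /sep uB vB hu hv.
  by apply: contraNneq nuv => ->.
- by move=> u v nuv /lab3 uy /lab3 vy; case/eqP: nuv; rewrite uy vy.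
Qed.

(** A path of length 3 between the two clusters consists of a leg, a core edge and a leg, so it
    needs the edge from [x] to [y]. *)
Lemma far_core_edge (E : rel T) x y r s : subrel E e -> ~~ E x y ->
  x != y -> r \in priv x -> s \in priv y -> s \notin ball E 3 r.
Proof.
move=> sub nE nxy /privP[rB hr] /privP[sB hs].
have b1 w : w \in ball E 1 r -> h w = x.
  by case/ball1P=> [->//|/sub/(side_adj cl rB)<-].
have b2 w : w \in ball E 2 r -> h w = x \/ (w \in B /\ w != y).
  case/ballSP=> [/b1|[z /b1 hz Ezw]]; first by left.
  case: (adj_home cl (sub _ _ Ezw)) => [<-|[zB wB]]; first by left.
  right; split=> //; apply: contraNneq nE => <-.
  by rewrite -hz (home_id cl zB).
apply/negP => /ballSP[/b2[hsx|[]]|[z /b2 zA Ezs]].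
- by rewrite -hsx hs eqxx in nxy.
- by rewrite (negPf sB).
- have hz : h z = y.
    by case: (adj_home cl (sub _ _ Ezs)) => [->|[_]]; rewrite ?hs ?(negPf sB).
  case: zA => [hzx|[zB]]; first by rewrite -hzx hz eqxx in nxy.
  by rewrite -hz (home_id cl zB) eqxx.
Qed.

(** A path of length 3 from [p] to another cluster has to begin with the leg to its home [x]. *)
Lemma far_leg (E : rel T) x p z s : subrel E e -> symmetric E -> ~~ E x p ->
  x \in B -> z != x -> p \in priv x -> s \in priv z ->
  s \notin ball E 3 p /\ p \notin ball E 3 s.
Proof.
move=> sub symE nE xB nzx /privP[pB hp] /privP[sB hs]; split.
  have b1 w : w \in ball E 1 p -> w \notin B /\ h w = x.
    case/ball1P=> [->//|Epw]; have hw := side_adj cl pB (sub _ _ Epw).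
    rewrite -hw hp; split=> //; apply: contraNN nE => wB.
    by rewrite -hp hw (home_id cl wB) symE.
  have b2 w : w \in ball E 2 p -> h w = x.
    case/ballSP=> [/b1[]//|[u /b1[uB hu] Euw]].
    by rewrite -(side_adj cl uB (sub _ _ Euw)).
  apply/negP => /ballSP[/b2|[u /b2 hu Eus]]; first by rewrite hs => E1; rewrite E1 eqxx in nzx.
  case: (adj_home cl (sub _ _ Eus)) => [hus|[_]]; last by rewrite (negPf sB).
  by rewrite -hs -hus hu eqxx in nzx.
have b1 w : w \in ball E 1 s -> h w = z.
  by case/ball1P=> [->//|/sub/(side_adj cl sB)<-].
have b2 w : w \in ball E 2 s -> h w = z \/ w \in B.
  case/ballSP=> [/b1|[u /b1 hu Euw]]; first by left.
  by case: (adj_home cl (sub _ _ Euw)) => [<-|[_ ?]]; [left | right].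
apply/negP => /ballSP[/b2[hpz|]|[u /b2 uA Eup]].
- by rewrite -hpz hp eqxx in nzx.
- by rewrite (negPf pB).
- have hu : h u = x.
    by case: (adj_home cl (sub _ _ Eup)) => [->|[_]]; rewrite ?hp ?(negPf pB).
  case: uA => [huz|uB]; first by rewrite -huz hu eqxx in nzx.
  by rewrite -(home_id cl uB) hu (negPf nE) in Eup.
Qed.

Lemma heavy_saves : deletion_saves e.
Proof.
apply: (deletion_saves_edges cl) => [x y xB yB nxy|x p xB pP|]; last exact: side_edge_saves.
  have [|R Rmax _] := @side_max_exists set0.
    by apply/side_indepP; split=> u; rewrite inE.
  have [iR _] := Rmax; have [|t tP _] := @spare_exists R x iR.
    by move=> z _; left; rewrite in_priv xB.
  have [r rA] := absorbs3_exists Rmax tP xB; have [s sA] := absorbs3_exists Rmax tP yB.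
  have nE : ~~ del_edge e x y x y by rewrite /del_edge /= eqxx andbF.
  have nE' : ~~ del_edge e x y y x by rewrite del_edge_sym.
  have sub := @del_edge_sub _ e x y; have [rP _] := rA; have [sP _] := sA.
  apply: (saves_by_absorption Rmax tP xB yB nxy rA sA) => //.
    exact: far_core_edge nE nxy rP sP.
  by apply: far_core_edge nE' _ sP rP; rewrite // eq_sym.
have [P2|P3] := eqVneq #|priv x| 2; first exact: thin_leg_saves.
have [_ [xH|[P2 _]]] := core_type xB; last by rewrite P2 in P3.
have [pB hp] := privP pP; have /heavyP[_ nl] := xH.
have /nloneP[q qB epq] := nl p pP.
(* Taking [R] through a neighbour [q] of [p] keeps [p] out of [R]; with [t] avoiding [p] as well,
   [p] is free for label 3. *)
have [R Rmax qR] : exists2 R, side_max R & q \in R.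
  have [|R Rmax] := @side_max_exists [set q].
    apply/side_indepP; split=> [u /set1P->//|u v /set1P-> /set1P->].
    exact: cl_irr cl q.
  by rewrite sub1set; exists R.
have [iR _] := Rmax; have [RB Re] := side_indepP _ iR.
have pR : p \notin R by apply/negP => pR; rewrite Re in epq.
have [|t tP tp] := @spare_exists R p iR.
  move=> z zH; have [zx|nzx] := eqVneq z x; first by right; rewrite zx.
  by left; rewrite in_priv hp eq_sym (negPf nzx) andbF.
have [z zB nzx] := core_other cl x; have nxz : x != z by rewrite eq_sym.
have [s sA] := absorbs3_exists Rmax tP zB; have [sP _] := sA.
have pA : absorbs3 R t x p.
  split=> //; right; split=> //; apply/imsetP => -[w wH pE].
  by have := tp w wH; rewrite -pE eqxx.
have nE : ~~ del_edge e x p x p by rewrite /del_edge /= eqxx andbF.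
have [] := far_leg (@del_edge_sub _ e x p) (del_edge_sym x p sym_e) nE xB nzx pP sP.
apply: (saves_by_absorption Rmax tP xB zB nxz pA sA).
by rewrite (negPf pR).
Qed.

End HeavyClusters.

(** * Both directions of the equivalence *)

Theorem theorem5p2 (T : finType) (e : rel T) (B : {set T}) :
  symmetric e -> irreflexive e ->
  block_graph e -> diameter3 e ->
  is_block e B -> (forall x, x \in B <-> in_center e x) ->
  (chi_rho_critical e <-> [\/ condA e B, condB e B | condC e B]).
Proof.
move=> esym eirr bg diam Bblock cenP.
have [h cl] := block_graph_clustered esym eirr bg diam Bblock cenP.
rewrite (critical_iff esym (nbr_exists cl)).
split=> [crit|]; first exact: (critical_cond cl crit).
have lightN x : 1 < #|priv B h x| -> (forall v, v \in priv B h x -> lone e B v) ->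
    x \notin heavy e B h.
  move=> /ltnW/card_gt0P[v vP] all; apply/negP => /heavyP[_ /(_ v vP)].
  by rewrite all.
case=> [/(condAP cl)|/(condBP cl)[y [yB y2 yN oth]]|[type [y [yB y12]]]].
- exact: condA_saves.
- have yH : y \in heavy e B h by apply/heavyP.
  have HE : heavy e B h = [set y].
    apply/setP => x; rewrite in_set1; apply/idP/eqP => [xH|->//].
    apply/eqP; apply: contraLR xH => nxy.
    have [xB|] := boolP (x \in B); last by rewrite inE => /negPf->.
    by have [x2 xl] := oth x xB nxy; apply: lightN; rewrite // x2.
  apply: (heavy_saves cl) => [x xB||x]; rewrite ?HE ?cards1 //.
    have [->|nxy] := eqVneq x y; first by rewrite y2 set11; split; last left.
    by have [x2 xl] := oth x xB nxy; rewrite x2; split; last right.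
  by move/set1P->.
- have heavy12 x : x \in B -> c1 e B x \/ c2 e B x ->
      x \in heavy e B h /\ 2 < #|priv B h x|.
    move=> xB /(c12P cl bg Bblock xB)[/eqP/(no_leaf_nbrP cl xB) nl P3].
    by split=> //; apply/heavyP.
  have ty x : x \in B -> (x \in heavy e B h /\ 2 < #|priv B h x|) \/
      (#|priv B h x| = 2 /\ forall v, v \in priv B h x -> lone e B v).
    move=> xB; case: (type x xB) => H.
    + by left; apply: heavy12 => //; left.
    + by left; apply: heavy12 => //; right.
    + by right; apply/(c3P cl xB).
  apply: (heavy_saves cl) => [x xB||x xH x2].
  + case: (ty x xB) => [[xH /ltnW x2]|[x2 xl]]; first by split; last left.
    by rewrite x2; split; last right.
  + by apply/card_gt0P; exists y; case: (heavy12 y yB y12).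
  + have /heavyP[xB _] := xH; case: (ty x xB) => [[_]|[_ xl]]; first by rewrite x2.
    by have := lightN x; rewrite x2 xH => /(_ isT xl).
Qed.
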